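(* Let $\mathcal{A} = \{A_1,\dots,A_k\}$ be a finite collection of arithmetic progressions $A_i = a_i + d_i\mathbb{Z}$ with distinct moduli $d_1,\dots,d_k \ge 616000$. Then $\mathcal{A}$ does not cover the integers, i.e. $\bigcup_{i=1}^k A_i \ne \mathbb{Z}$.
   Context: An arithmetic progression with modulus $d$ is a set of the form $a + d\mathbb{Z}$ with $a \in \mathbb{Z}$, $d \in \mathbb{N}$. *)

(* Defs.v *)
From mathcomp Require Import all_boot all_order all_algebra.
From mathcomp Require Import classical_sets.

Set Implicit Arguments.
Unset Strict Implicit.
Unset Printing Implicit Defensive.

Local Open Scope ring_scope.
Local Open Scope classical_set_scope.

Definition arith_prog (a : int) (d : nat) : set int :=
  [set a + d%:Z * m | m in [set: int]].

(* Main.v *)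
(** Distortion method of Balister, Bollobas, Morris, Sahasrabudhe and Tiba.  Let
    [r d] be any choice of residues.  Going through the primes [q] in order, we
    build nonnegative weights on the residues modulo the [q]-smooth part of a
    large number, vanishing on every progression [r d + dZ] treated so far.  A
    fibre of which a proportion [alpha] is newly covered is reweighted by
    [min (1 / (1 - alpha)) (4 / 3)] outside the covered part, so that it loses
    only the fraction [max ((4 alpha - 1) / 3) 0] of its mass.  It is enough to
    show that the total loss is less than 1.

    The number of progressions through a point is dominated, in the convex
    order, by the number of divisors [tau] of a random smooth number: for given
    marginals the worst case is the one where the progressions are nested.  Hence
    the loss at [q] is at most [4 / (3 (q - 1)) * E (tau - (q - 1) / 4)^+], which
    improves on the second moment bound [4 / 3 * E tau^2 / (q - 1)^2].

    - For [q < 200] nothing is reweighted; at 200 all 199-smooth moduli are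
      removed at once, at the cost [sum 1 / d] over smooth [d >= 616000].
    - For [200 <= q < 4000] the law of [tau] is computed explicitly.
    - For [4000 <= q < 2 ^ 17] the second moment is used, along a sieve.
    - For [q >= 2 ^ 17] the second moment is used on dyadic blocks, with
      Chebyshev's bound on the number of primes. *)

From Stdlib Require Import NArith.
Require Import Defs.
From mathcomp Require Import all_boot all_order all_algebra.
From mathcomp Require Import classical_sets.
From mathcomp Require Import zify ring lra.

Set Implicit Arguments.
Unset Strict Implicit.
Unset Printing Implicit Defensive.

Import Order.TTheory GRing.Theory Num.Theory.

Local Open Scope ring_scope.

(** * Sums over residues and divisors *)

Section Sums.
Variable R : realFieldType.
Implicit Types (x y D u : R).

Lemma sum_fibres (f : nat -> R) Q q :
  \sum_(x < Q * q) f x = \sum_(x < Q) \sum_(t < q) f (x + t * Q)%N.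
Proof.
rewrite exchange_big /= mulnC.
rewrite -(big_mkord xpredT f) big_nat_mul big_mkord; apply: eq_bigr => t _.
rewrite -{1}[(t * Q)%N]add0n big_addn mulSn addnK big_mkord.
by apply: eq_bigr.
Qed.

Lemma sum_le1 n (P : pred 'I_n) :
  (forall i k : 'I_n, P i -> P k -> i = k) -> \sum_(i < n) (P i)%:R <= 1 :> R.
Proof.
move=> uniP; case: (pickP P) => [i Pi|P0]; last by rewrite big1 // => i _; rewrite P0.
rewrite (bigD1 i) //= Pi big1 ?addr0 // => k; case: (boolP (P k)) => // Pk.
by rewrite (uniP _ _ Pk Pi) eqxx.
Qed.

Lemma modn_mull_inj c m s t :
  coprime c m -> (s < m)%N -> (t < m)%N -> s * c = t * c %[mod m] -> s = t.
Proof.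
move=> co_cm; wlog le_ts : s t / (t <= s)%N => [hw sm tm e|].
  by case/orP: (leq_total t s) => h; [apply: hw | apply/esym/hw].
move=> sm tm /eqP; rewrite eqn_mod_dvd ?leq_mul2r ?le_ts ?orbT // -mulnBl.
by rewrite Gauss_dvdl 1?coprime_sym // -eqn_mod_dvd // !modn_small // => /eqP.
Qed.

(** Write [t] as [s + r * q ^ j]. As [c] is invertible mod [q ^ j], each of the [q ^ (G - j)] values
    of [r] leaves at most one [s]. *)
Lemma count_residue q j G c b a : coprime c (q ^ j) -> (j <= G)%N ->
  \sum_(t < q ^ G) (b + t * c == a %[mod q ^ j])%:R <= (q ^ (G - j))%:R :> R.
Proof.
move=> co_c lejG.
have -> : (q ^ G = q ^ j * q ^ (G - j))%N by rewrite -expnD subnKC.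
rewrite (sum_fibres (fun t => (b + t * c == a %[mod q ^ j])%:R)) exchange_big /=.
rewrite -[leRHS]mulr1 mulr_natl -[X in _ *+ X]card_ord -sumr_const.
apply: ler_sum => r _; apply: sum_le1 => s t /= /eqP es /eqP et.
apply/val_inj/(modn_mull_inj co_c); rewrite ?ltn_ord //.
move: et; rewrite -es => /eqP; rewrite eqn_modDl => /eqP.
have E k : ((k + r * q ^ j) * c = k * c + r * c * q ^ j)%N.
  by rewrite mulnDl mulnAC.
by rewrite !E ![(_ + r * c * _)%N]addnC !modnMDl.
Qed.

Lemma big_divisors_mul (f : nat -> R) q G Q :
  prime q -> coprime Q q -> (0 < Q)%N ->
  \sum_(d <- divisors (Q * q ^ G)) f d =
  \sum_(j < G.+1) \sum_(m <- divisors Q) f (m * q ^ j)%N.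
Proof.
move=> pq coQ Q0; have q0 := prime_gt0 pq.
rewrite -(big_mkord xpredT (fun j => \sum_(m <- divisors Q) f (m * q ^ j)%N)).
rewrite /index_iota subn0.
rewrite -(@big_allpairs_dep _ _ _ _ (fun=> nat) _ (fun j m => m * q ^ j)%N _ (fun=> divisors Q)).
apply: perm_big; apply: uniq_perm; first exact: divisors_uniq.
  apply: allpairs_uniq; rewrite ?iota_uniq ?divisors_uniq //.
  move=> _ _ /allpairsP[[j' m'] [_ mQ ->]] /allpairsP[[k' l'] [_ lQ ->]] /= e.
  simpl in mQ, lQ.
  rewrite -!dvdn_divisors // in mQ lQ.
  have co_q z : (z %| Q)%N -> coprime q z.
    by move=> zQ; rewrite coprime_sym; apply: coprime_dvdl zQ coQ.
  have z0 z : (z %| Q)%N -> (0 < z)%N by apply: dvdn_gt0.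
  have jk : j' = k'.
    have := congr1 (logn q) e; rewrite !logn_Gauss ?co_q //.
    by rewrite !pfactorK.
  by move/eqP: e; rewrite jk eqn_mul2r expn_eq0 eqn0Ngt q0 /= => /eqP ->.
move=> d; rewrite -dvdn_divisors ?muln_gt0 ?Q0 ?expn_gt0 ?q0 //.
apply/idP/allpairsPdep => [dv|[j [m [jG mQ ->]]]].
  have d0 : (0 < d)%N by apply: dvdn_gt0 dv; rewrite muln_gt0 Q0 expn_gt0 q0.
  have [m co_m e] := pfactor_coprime pq d0.
  exists (logn q d), m; split => //.
    rewrite mem_iota /= ltnS; have := dvdn_leq_log q _ dv.
    by rewrite logn_Gauss 1?coprime_sym // pfactorK //; apply; rewrite muln_gt0 Q0 expn_gt0 q0.
  rewrite -dvdn_divisors // -(@Gauss_dvdl _ Q (q ^ G)) ?coprimeXr 1?coprime_sym //.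
  by apply: dvdn_trans dv; rewrite e dvdn_mulr.
rewrite mem_iota /= ltnS in jG; rewrite -dvdn_divisors // in mQ.
by apply: dvdn_mul => //; apply: dvdn_exp2l.
Qed.

End Sums.

(** * Nested progressions are the worst case *)

Section Comonotone.
Variable R : realFieldType.
Implicit Types (x y D u : R).

Definition pos x : R := Num.max x 0.

Lemma pos_ge0 x : 0 <= pos x. Proof. by rewrite le_max lexx orbT. Qed.
Lemma pos_ge x : x <= pos x. Proof. by rewrite le_max lexx. Qed.
Lemma pos_le x y : x <= y -> 0 <= y -> pos x <= y.
Proof. by move=> xy y0; rewrite ge_max xy. Qed.
Lemma le_pos x y : x <= y -> pos x <= pos y.
Proof. by move=> xy; apply: pos_le (pos_ge0 _); apply: le_trans xy (pos_ge _). Qed.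
Lemma pos_id x : 0 <= x -> pos x = x. Proof. by move=> x0; apply/max_idPl. Qed.
Lemma pos_eq0 x : x <= 0 -> pos x = 0. Proof. by move=> x0; apply/max_idPr. Qed.
Lemma posM c x : 0 <= c -> pos (c * x) = c * pos x.
Proof. by move=> c0; rewrite /pos maxr_pMr // mulr0. Qed.
Lemma ler_pos_sum n (f : nat -> R) : pos (\sum_(j < n) f j) <= \sum_(j < n) pos (f j).
Proof.
by apply: pos_le; [apply: ler_sum => j _; apply: pos_ge | apply: sumr_ge0 => j _; apply: pos_ge0].
Qed.

(** Subadditivity of [pos], with [D] shared equally among the terms. It trades the tail of a sum at
    height [D] for tails of single terms at [D / n.+1]. *)
Lemma pos_mean n (f : nat -> R) D :
  pos (\sum_(j < n.+1) f j - D) <= \sum_(j < n.+1) pos (f j - D / n.+1%:R).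
Proof.
apply: le_trans (ler_pos_sum _ (fun j => f j - D / n.+1%:R)); apply: le_pos.
by rewrite sumrB sumr_const card_ord -[_ *+ n.+1]mulr_natr divfK ?pnatr_eq0.
Qed.

(* If the events behind the [Y j] are nested, with [Y j] at its maximum [N j]
   for [j < v] and 0 afterwards, then [pos (sum Y - D)] is [h v]; [th] is the
   slope of [h], and the linear form it defines dominates every configuration. *)
Lemma pos_slopes n (N : nat -> R) D : (forall j, 0 <= N j) -> 0 <= D ->
  let h v := pos (\sum_(j < v) N j - D) in
  exists th : nat -> R, [/\ forall j, 0 <= th j,
    forall j, N j * th j = h j.+1 - h j &
    forall Y : nat -> R, (forall j, 0 <= Y j <= N j) ->
      pos (\sum_(j < n) Y j - D) <= \sum_(j < n) Y j * th j].
Proof.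
move=> N0 D0 h; exists (fun j => (h j.+1 - h j) / N j).
have hS j : h j <= h j.+1 <= h j + N j.
  rewrite /h big_ord_recr /=; apply/andP; split.
    by apply: le_pos; rewrite lerD2r lerDl.
  apply: pos_le; last by rewrite addr_ge0 ?pos_ge0.
  by rewrite addrAC lerD2r pos_ge.
have Nth j : N j * ((h j.+1 - h j) / N j) = h j.+1 - h j.
  (* If [N j = 0], the quotient is 0 by convention, and [hS] forces [h j.+1 = h j]. *)
  have [Nj|Nj] := eqVneq (N j) 0; last by rewrite mulrC divfK.
  by have := hS j; rewrite Nj; lra.
have th0 j : 0 <= (h j.+1 - h j) / N j.
  by rewrite divr_ge0 // subr_ge0; case/andP: (hS j).
split=> // Y YN; apply: pos_le; last first.
  by apply: sumr_ge0 => j _; rewrite mulr_ge0 //; case/andP: (YN j).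
(* Slopes are at most 1, so [Y j * (1 - th j)] is largest at [Y j = N j]; there the sum telescopes
   to [\sum N j - h n], which is at most [D]. *)
rewrite lerBlDr -lerBlDl -sumrB.
apply: (@le_trans _ _ (\sum_(j < n) (N j - (h j.+1 - h j)))).
  apply: ler_sum => j _; rewrite -[X in _ <= N j - X]Nth.
  set th := _ / N j; rewrite -{1}[Y j]mulr1 -{1}[N j]mulr1 -!mulrBr.
  case/andP: (YN j) => Y0 YNj; have [Nj|Nj] := eqVneq (N j) 0.
    have Yj : Y j = 0 by apply: le_anti; rewrite Y0 andbT -Nj.
    by rewrite Yj Nj !mul0r.
  apply: ler_wpM2r => //; rewrite subr_ge0 /th ler_pdivrMr ?lt_def ?Nj ?N0 //.
  by have := hS j; lra.
rewrite sumrB -(big_mkord xpredT (fun j => h j.+1 - h j)) telescope_sumr //.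
by have := pos_ge (\sum_(j < n) N j - D); rewrite -/(h n) /h !big_ord0 sub0r (@pos_eq0 (- D)) ?oppr_le0 //; lra.
Qed.

(** Group the products in the square by their larger index [j], and replace the factor of smaller or
    equal index by its maximum. *)
Lemma sqr_sum_le n (N Y : nat -> R) : (forall j, 0 <= Y j <= N j) ->
  (\sum_(j < n) Y j) ^+ 2 <= \sum_(j < n) Y j * (2 * \sum_(k < j) N k + N j).
Proof.
move=> YN; elim: n => [|n IH]; first by rewrite !big_ord0 expr0n.
rewrite !big_ord_recr /= sqrrD -addrA; apply: lerD => //.
have le_YN : \sum_(k < n) Y k <= \sum_(k < n) N k.
  by apply: ler_sum => k _; case/andP: (YN k).
by case/andP: (YN n) => Y0 YNn; rewrite expr2 -mulr_natl; nra.
Qed.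

Variables (T n : nat) (g : nat -> R) (Y : nat -> nat -> R) (s N : nat -> R).
Hypotheses (g0 : forall t, 0 <= g t) (YN : forall t j, 0 <= Y j t <= N j).
Hypothesis gY : forall j, (j < n)%N -> \sum_(t < T) g t * Y j t <= s j * N j.

Let N0 j : 0 <= N j.
Proof. by case/andP: (YN 0 j) => /le_trans; apply. Qed.

(** A linear majorant of [f] involves only the means of the [Y j], so their joint law is
    irrelevant. *)
Lemma mean_le_weighted (f : R -> R) (c : nat -> R) :
  (forall j, 0 <= c j) ->
  (forall t, f (\sum_(j < n) Y j t) <= \sum_(j < n) Y j t * c j) ->
  \sum_(t < T) g t * f (\sum_(j < n) Y j t) <= \sum_(j < n) s j * (N j * c j).
Proof.
move=> c0 le_f; apply: (@le_trans _ _ (\sum_(t < T) \sum_(j < n) g t * Y j t * c j)).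
  apply: ler_sum => t _; apply: le_trans (ler_wpM2l (g0 t) (le_f t)) _.
  by rewrite mulr_sumr; apply: ler_sum => j _; rewrite mulrA.
rewrite exchange_big /=; apply: ler_sum => j _.
by rewrite -mulr_suml mulrA ler_wpM2r // gY.
Qed.

Lemma mean_pos_le D : 0 <= D ->
  \sum_(t < T) g t * pos (\sum_(j < n) Y j t - D) <=
  \sum_(j < n) s j * (pos (\sum_(k < j.+1) N k - D) - pos (\sum_(k < j) N k - D)).
Proof.
move=> D0; have [th [th0 Nth le_th]] := pos_slopes n N0 D0.
apply: le_trans (mean_le_weighted (f := fun x => pos (x - D)) th0 _) _ => [t|].
  by apply: (le_th (Y^~ t)) => j; apply: YN.
by apply: ler_sum => j _; rewrite Nth.
Qed.

Lemma mean_sqr_le :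
  \sum_(t < T) g t * (\sum_(j < n) Y j t) ^+ 2 <=
  \sum_(j < n) s j * (N j * (2 * \sum_(k < j) N k + N j)).
Proof.
apply: (mean_le_weighted (f := fun x => x ^+ 2) (c := fun j => 2 * \sum_(k < j) N k + N j)).
  by move=> j; rewrite addr_ge0 // mulr_ge0 // sumr_ge0.
by move=> t; apply: (@sqr_sum_le n N (Y^~ t)) => j; apply: YN.
Qed.

End Comonotone.

(** * Laws bounding the number of progressions through a point *)

Section Lift.
Variable R : realFieldType.
Implicit Types (D E F u : R) (W : nat -> R) (mu : seq (nat * R)) (rho : nat -> nat).

Definition hits Q rho x : R := \sum_(m <- divisors Q) (x == rho m %[mod m])%:R.

Lemma hits_ge0 Q rho x : 0 <= hits Q rho x.
Proof. by apply: sumr_ge0 => m _; apply: ler0n. Qed.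

(* [mu] is a law of a random integer [tau], as a list of (value, probability)
   pairs, and [E] bounds its mean.  As [(t - D)^+ = t - D + (D - t)^+], the bound
   [E - D + below mu 1 D] stands for [E (tau - D)^+]: only the values of [tau]
   below [Dm] have to be listed in [mu]. *)
Definition below mu k D : R := \sum_(z <- mu) z.2 * pos (D - (k * z.1)%:R).

Definition tail_bound Q W Dm E mu := forall rho D, 0 <= D <= Dm ->
  \sum_(x < Q) W x * pos (hits Q rho x - D) <= E - D + below mu 1 D.

(** As in [tail_bound], [rho] is arbitrary: at the next prime the moduli [m * q ^ j] induce, for
    each [j], a new system [fun m => rho (m * q ^ j)]. *)
Definition square_bound Q W F := forall rho,
  \sum_(x < Q) W x * hits Q rho x ^+ 2 <= F.

Lemma belowZ mu v D : v.+1%:R * below mu 1 (D / v.+1%:R) = below mu v.+1 D.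
Proof.
rewrite /below mulr_sumr; apply: eq_bigr => z _; rewrite mulrCA -posM ?ler0n //.
by rewrite mulrBr (mulrCA _ D) divff ?pnatr_eq0 // mulr1 mul1n natrM.
Qed.

Lemma below_antitone mu v D : (forall z, z \in mu -> 0 <= z.2) ->
  below mu v.+1 D <= below mu v D.
Proof.
move=> mu0; rewrite /below big_seq [leRHS]big_seq; apply: ler_sum => z /mu0 z0.
by apply: ler_wpM2l => //; apply: le_pos; rewrite lerD2l lerN2 ler_nat leq_mul2r leqnSn orbT.
Qed.

Lemma abel n (s h : nat -> R) : h 0%N = 0 ->
  \sum_(v < n.+1) s v * (h v.+1 - h v) =
  s n * h n.+1 + \sum_(v < n) (s v - s v.+1) * h v.+1.
Proof.
move=> h0; elim: n => [|n IH]; first by rewrite big_ord_recr !big_ord0 /= h0; ring.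
by rewrite big_ord_recr IH [in RHS]big_ord_recr /=; ring.
Qed.

Section Geometric.
Variables (q : nat) (u : R).
Hypotheses (q1 : (1 < q)%N) (u0 : 0 <= u).
Let a : R := q%:R.
Let a1 : 1 < a. Proof. by rewrite ltr1n. Qed.

Lemma geom_sum_le G : \sum_(j < G) u / a ^+ j.+1 <= u / (a - 1).
Proof.
have -> : \sum_(j < G) u / a ^+ j.+1 = u / (a - 1) - u / (a ^+ G * (a - 1)).
  elim: G => [|G IH]; first by rewrite big_ord0 expr0 mul1r subrr.
  rewrite big_ord_recr IH /= (exprS a G); have := a1.
  have : a ^+ G != 0 by rewrite expf_neq0 //; have := a1; lra.
  by move=> *; field; apply/and3P; split=> //; lra.
by have := a1; rewrite gerBl => ?; rewrite divr_ge0 // mulr_ge0 ?exprn_ge0; lra.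
Qed.

(** The weights are differences of consecutive squares. The right side is the full series; the
    remainder is explicit, checked by induction, and nonnegative. *)
Lemma odd_geom_sum_le G :
  \sum_(j < G) (2 * j.+1%:R + 1) * (u / a ^+ j.+1) <= u * (3 * a - 1) / (a - 1) ^+ 2.
Proof.
have -> : \sum_(j < G) (2 * j.+1%:R + 1) * (u / a ^+ j.+1) =
  u * (3 * a - 1) / (a - 1) ^+ 2 -
  u * ((2 * G%:R + 3) * a - (2 * G%:R + 1)) / (a ^+ G * (a - 1) ^+ 2).
  elim: G => [|G IH]; first by rewrite big_ord0 expr0 !mulr0 !add0r !mul1r subrr.
  rewrite big_ord_recr IH /= (exprS a G) -[G.+1%:R]natr1; have := a1.
  have : a ^+ G != 0 by rewrite expf_neq0 //; have := a1; lra.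
  by move=> *; field; apply/and3P; split=> //; lra.
have := a1; rewrite gerBl => ?; have G0 : 0 <= G%:R :> R by [].
rewrite divr_ge0 ?mulr_ge0 ?exprn_ge0 //; try lra.
by nra.
Qed.
End Geometric.
End Lift.

(** * Lifting a weight to one more prime *)

Section Extension.
Variable R : realFieldType.
Variables (Q q G : nat) (u : R) (W : nat -> R) (g : nat -> nat -> R).
Hypotheses (pq : prime q) (coQ : coprime Q q) (Q0 : (0 < Q)%N).
Hypotheses (W0 : forall x, 0 <= W x).
Hypotheses (g0 : forall x t, 0 <= g x t <= u / (q ^ G)%:R).
Hypothesis g1 : forall x, \sum_(t < q ^ G) g x t <= 1.
Implicit Types (D E F : R) (mu : seq (nat * R)) (rho : nat -> nat).

(** A residue mod [Q * q ^ G] is [x + t * Q], weighted by [W] at [x] and by [g x] along the fibre.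
    The density bound [u] is 1 for uniform fibres and 4/3 for distorted ones. *)
Definition lift_weight x : R := W (x %% Q) * g (x %% Q) (x %/ Q).

Lemma sum_lift (f : nat -> R) :
  \sum_(x < Q * q ^ G) lift_weight x * f x =
  \sum_(x < Q) W x * \sum_(t < q ^ G) g x t * f (x + t * Q)%N.
Proof.
rewrite (sum_fibres (fun x => lift_weight x * f x)); apply: eq_bigr => x _.
rewrite mulr_sumr; apply: eq_bigr => t _; rewrite /lift_weight addnC.
by rewrite modnMDl modn_small // divnMDl // divn_small // addn0 mulrA.
Qed.

Let q0 : (0 < q)%N := prime_gt0 pq.
Let u0 : 0 <= u.
Proof.
have /andP[a b] := g0 0 0; have := le_trans a b.
by rewrite pmulr_lge0 // invr_gt0 ltr0n expn_gt0 q0.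
Qed.

(* A bound for the probability that a point lies in a given class mod [q ^ j]. *)
Definition survival j : R := if j is i.+1 then if (j <= G)%N then u / (q ^ j)%:R else 0 else 1.

Local Notation s := survival.

(** The share of [hits] due to moduli with exact power [q ^ j], each congruence being split by the
    Chinese remainder theorem. *)
Definition fibre_hits rho j x t : R := \sum_(m <- divisors Q)
  (x == rho (m * q ^ j)%N %[mod m])%:R * (x + t * Q == rho (m * q ^ j)%N %[mod q ^ j])%:R.

Local Notation Y := fibre_hits.
Local Notation N rho j x := (hits R Q (fun m => rho (m * q ^ j)%N) x).

Lemma fibre_hits_bounds rho x t j : 0 <= Y rho j x t <= N rho j x.
Proof.
apply/andP; split; first by apply: sumr_ge0 => m _; rewrite mulr_ge0.
by apply: ler_sum => m _; case: (_ == _ %[mod m]); case: (_ == _ %[mod q ^ j]);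
  rewrite ?mulr1 ?mulr0 ?mul0r.
Qed.

Lemma hits_lift rho x t :
  hits R (Q * q ^ G) rho (x + t * Q) = \sum_(j < G.+1) Y rho j x t.
Proof.
rewrite /hits big_divisors_mul //; apply: eq_bigr => j _.
rewrite [LHS]big_seq [RHS]big_seq; apply: eq_bigr => m.
rewrite -dvdn_divisors // => mQ.
have co : coprime m (q ^ j) by rewrite coprimeXr // (coprime_dvdl mQ).
rewrite chinese_remainder //.
have -> : (x + t * Q == rho (m * q ^ j)%N %[mod m]) = (x == rho (m * q ^ j)%N %[mod m]).
  by case/dvdnP: mQ => k ->; rewrite mulnA addnC modnMDl.
by rewrite -mulnb natrM.
Qed.

(** For [j = 0] the fibre has mass at most 1. Otherwise the density bound [u / q ^ G] is multiplied
    by the [q ^ (G - j)] points of [count_residue]. *)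
Lemma mean_fibre_hits rho x j : (j < G.+1)%N ->
  \sum_(t < q ^ G) g x t * Y rho j x t <= s j * N rho j x.
Proof.
move=> jG; case: j jG => [|j] jG.
  apply: (@le_trans _ _ (\sum_(t < q ^ G) g x t * N rho 0 x)).
    apply: ler_sum => t _; case/andP: (g0 x t) => ? _.
    by apply: ler_wpM2l => //; case/andP: (fibre_hits_bounds rho x t 0).
  by rewrite -mulr_suml ler_wpM2r ?hits_ge0.
rewrite ltnS in jG; rewrite /survival jG /fibre_hits; under eq_bigr do rewrite mulr_sumr.
rewrite exchange_big /= mulr_sumr big_seq [leRHS]big_seq.
apply: ler_sum => m; rewrite -dvdn_divisors // => mQ.
case: (_ == _ %[mod m]); last first.
  by rewrite mulr0 big1 // => t _; rewrite mul0r mulr0.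
under eq_bigr do rewrite mul1r; rewrite mulr1.
have co : coprime Q (q ^ j.+1) by rewrite coprimeXr.
apply: (@le_trans _ _ (u / (q ^ G)%:R * (q ^ (G - j.+1))%:R)); last first.
  rewrite -{1}(subnKC jG) expnD natrM invfM mulrA -mulrA mulVf ?mulr1 //.
  by rewrite pnatr_eq0 expn_eq0 negb_and -lt0n q0.
apply: le_trans (ler_wpM2l _ (@count_residue R q j.+1 G Q x _ co jG)); last first.
  by rewrite divr_ge0.
rewrite mulr_sumr; apply: ler_sum => t _; apply: ler_wpM2r => //.
by case/andP: (g0 x t).
Qed.

Let h rho D v x := pos (\sum_(j < v) N rho j x - D).

(** Summation by parts in [mean_pos_le]: in the nested worst case, [s v - s v.+1] is the probability
    that exactly the levels up to [v] are hit. *)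
Lemma fibre_tail rho D x : 0 <= D ->
  \sum_(t < q ^ G) g x t * pos (hits R (Q * q ^ G) rho (x + t * Q) - D) <=
  \sum_(v < G.+1) (s v - s v.+1) * h rho D v.+1 x.
Proof.
move=> D0; under eq_bigr do rewrite hits_lift.
have gx t : 0 <= g x t by case/andP: (g0 x t).
apply: le_trans (mean_pos_le gx (fun t j => fibre_hits_bounds rho x t j) (@mean_fibre_hits rho x) D0) _.
have := @abel R G.+1 s (fun v => h rho D v x).
rewrite {1}/h big_ord0 sub0r pos_eq0 ?oppr_le0 // => /(_ erefl).
by rewrite big_ord_recr /= {2 3}/survival ltnn !mul0r addr0 add0r => ->.
Qed.

Hypothesis uq : u <= q%:R.

Lemma survival_antitone v : s v.+1 <= s v.
Proof.
have q1 : 1 <= q%:R :> R by rewrite ler1n.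
case: v => [|v] /=.
  by rewrite expn1; case: ifP => _ //; rewrite ler_pdivrMr ?mul1r // ltr0n.
case: ifP => [vG|_]; last by case: ifP => // _; rewrite divr_ge0.
rewrite (ltnW vG); apply: ler_wpM2l => //.
rewrite lef_pV2 ?posrE ?ltr0n ?expn_gt0 ?q0 // ler_nat.
by rewrite leq_exp2l ?prime_gt1.
Qed.

(** With probability [s v - s v.+1] the count is a sum of [v + 1] counts, each compared with [tau]
    at threshold [D / (v + 1)]; so [tau] is multiplied by [v + 1]. Undoing the summation by parts
    separates the growth of the mean from the [below] terms, whose differences are nonnegative, so
    that [t] may replace the true probabilities. *)
Lemma tail_bound_lift Dm E mu V (t : nat -> R) rho D :
  (V <= G)%N -> (forall z, z \in mu -> 0 <= z.2) ->
  (forall v, (v < V)%N -> t v <= u / (q ^ v.+1)%:R) ->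
  tail_bound Q W Dm E mu -> 0 <= D <= Dm ->
  \sum_(x < Q * q ^ G) lift_weight x * pos (hits R (Q * q ^ G) rho x - D) <=
  E * (1 + u / (q%:R - 1)) - D +
  (below mu 1 D - \sum_(v < V) t v * (below mu v.+1 D - below mu v.+2 D)).
Proof.
move=> VG mu0 tV tb /andP[D0 DDm].
have E0 : 0 <= E.
  have := tb rho 0; rewrite lexx (le_trans D0 DDm) => /(_ isT).
  have -> : below mu 1 0 = 0.
    by apply: big1 => z _; rewrite pos_eq0 ?mulr0 // sub0r oppr_le0.
  rewrite subr0 addr0.
  by apply: le_trans; apply: sumr_ge0 => x _; rewrite mulr_ge0 ?pos_ge0.
rewrite (sum_lift (fun x => pos (hits R (Q * q ^ G) rho x - D))).
apply: (@le_trans _ _ (\sum_(v < G.+1) (s v - s v.+1) * \sum_(x < Q) W x * h rho D v.+1 x)).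
  under [leRHS]eq_bigr do rewrite mulr_sumr.
  rewrite exchange_big /=; apply: ler_sum => x _.
  apply: le_trans (ler_wpM2l (W0 _) (fibre_tail rho x D0)) _.
  by rewrite mulr_sumr; apply: ler_sum => v _; rewrite mulrCA.
(* [H v] bounds the mean of [(tau * (v + 1) - D)^+], in the form used by [tail_bound]. *)
pose H v : R := v.+1%:R * E - D + below mu v.+1 D.
apply: (@le_trans _ _ (\sum_(v < G.+1) (s v - s v.+1) * H v)).
  apply: ler_sum => v _; apply: ler_wpM2l; first by rewrite subr_ge0 survival_antitone.
  apply: (@le_trans _ _ (\sum_(j < v.+1) \sum_(x < Q) W x * pos (N rho j x - D / v.+1%:R))).
    rewrite exchange_big /=; apply: ler_sum => x _; rewrite -mulr_sumr.
    by apply: ler_wpM2l => //; apply: (pos_mean v (fun j => N rho j x)).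
  have v0 : 0 < v.+1%:R :> R by rewrite ltr0n.
  have Dv : 0 <= D / v.+1%:R <= Dm.
    rewrite divr_ge0 //= (le_trans _ DDm) // ler_pdivrMr // ler_peMr // ler1n //.
  apply: le_trans (ler_sum _ (fun (j : 'I_v.+1) _ => tb (fun m => rho (m * q ^ j)%N) _ Dv)) _.
  rewrite sumr_const card_ord /H -[below mu v.+1 D]belowZ -[leLHS]mulr_natl.
  have : D = v.+1%:R * (D / v.+1%:R) by rewrite mulrC divfK ?lt0r_neq0.
  by move: (D / _) (below _ _ _) => d b; lra.
have := @abel R G.+1 s (fun v => if v is w.+1 then H w else 0) erefl.
have -> : s G.+1 = 0 by rewrite /survival ltnn.
rewrite mul0r add0r => <-; rewrite big_ord_recl /=.
rewrite mul1r subr0.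
have HS v : H v.+1 - H v = E - (below mu v.+1 D - below mu v.+2 D).
  by rewrite /H -[v.+2%:R]natr1; ring.
under eq_bigr do rewrite /bump /= add1n HS.
rewrite big_ord_recr /= ltnn mul0r addr0.
have -> : \sum_(i < G) (if (i < G)%N then u / (q ^ i.+1)%:R else 0) *
    (E - (below mu i.+1 D - below mu i.+2 D)) =
  E * \sum_(i < G) u / q%:R ^+ i.+1 -
  \sum_(i < G) u / (q ^ i.+1)%:R * (below mu i.+1 D - below mu i.+2 D).
  rewrite mulr_sumr -sumrB; apply: eq_bigr => i _; rewrite ltn_ord -natrX; ring.
rewrite {1}/H.
have geo := geom_sum_le (prime_gt1 pq) u0 G.
have {}geo := ler_wpM2l E0 geo.
suff : \sum_(v < V) t v * (below mu v.+1 D - below mu v.+2 D) <=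
   \sum_(i < G) u / (q ^ i.+1)%:R * (below mu i.+1 D - below mu i.+2 D) by lra.
have d0 v : 0 <= below mu v.+1 D - below mu v.+2 D.
  by rewrite subr_ge0 below_antitone.
rewrite -(subnKC VG) big_split_ord /=; apply: ler_wpDr.
  by apply: sumr_ge0 => i _; rewrite mulr_ge0 // divr_ge0.
by apply: ler_sum => v _; apply: ler_wpM2r => //; apply: tV.
Qed.

(** Cross terms are split by [2 * x * y <= x ^ 2 + y ^ 2]; each square has mean at most [F], so
    level [j] costs [(2 * j + 1) * F] times its probability. *)
Lemma square_bound_lift F : square_bound Q W F ->
  square_bound (Q * q ^ G) lift_weight (F * (1 + u * (3 * q%:R - 1) / (q%:R - 1) ^+ 2)).
Proof.
move=> sb rho; rewrite (sum_lift (fun x => hits R (Q * q ^ G) rho x ^+ 2)).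
have s0 j : 0 <= s j by rewrite /s; case: j => // j; case: ifP => // _; rewrite divr_ge0.
apply: (@le_trans _ _ (\sum_(x < Q) W x * \sum_(j < G.+1)
    s j * (\sum_(k < j) (N rho j x ^+ 2 + N rho k x ^+ 2) + N rho j x ^+ 2))).
  apply: ler_sum => x _; apply: ler_wpM2l => //.
  under eq_bigr do rewrite hits_lift.
  have gx t : 0 <= g x t by case/andP: (g0 x t).
  apply: le_trans (mean_sqr_le gx (fun t j => fibre_hits_bounds rho x t j) (@mean_fibre_hits rho x)) _.
  apply: ler_sum => j _; apply: ler_wpM2l => //.
  rewrite mulrDr -expr2 lerD2r mulr_sumr mulr_sumr; apply: ler_sum => k _.
  by have := sqr_ge0 (N rho j x - N rho k x); rewrite sqrrB; lra.
under eq_bigr do rewrite mulr_sumr; rewrite exchange_big /=.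
apply: (@le_trans _ _ (\sum_(j < G.+1) s j * ((2 * j%:R + 1) * F))).
  apply: ler_sum => j _; under eq_bigr do rewrite mulrCA.
  rewrite -mulr_sumr; apply: ler_wpM2l => //.
  under eq_bigr do rewrite mulrDr mulr_sumr.
  rewrite big_split /= exchange_big /= [(2 * _ + 1) * F]mulrDl mul1r.
  apply: lerD; last exact: sb.
  have -> : 2 * j%:R * F = \sum_(k < j) (F + F).
    by rewrite sumr_const card_ord -mulr_natl; ring.
  apply: ler_sum => k _; under eq_bigr do rewrite mulrDr.
  by rewrite big_split /=; apply: lerD; apply: sb.
have F0 : 0 <= F.
  by apply: le_trans (sb rho); apply: sumr_ge0 => x _; rewrite mulr_ge0 ?sqr_ge0.
rewrite big_ord_recl /= mul1r mulr0 add0r mul1r mulrDr mulr1 lerD2l.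
apply: le_trans (ler_wpM2l F0 (odd_geom_sum_le (prime_gt1 pq) u0 G)).
rewrite mulr_sumr; apply: ler_sum => j _.
by rewrite /bump /= add1n ltn_ord -natrX; lra.
Qed.

End Extension.

(** * One distortion step *)

Section Distortion.
Variable R : realFieldType.
Variables (r : nat -> nat) (K : nat).
Implicit Types (B D E F u : R) (W : nat -> R) (mu : seq (nat * R)) (rho : nat -> nat).

Definition avoids Q W := forall x, (x < Q)%N -> W x != 0 ->
  forall d, (d %| Q)%N -> (K <= d)%N -> x != r d %[mod d].

(** The lost fraction of a fibre is at most [4 / 3 * (alpha - 1 / 4)^+]. Since [alpha] is at most
    the sum of [n j / q ^ j] over [j >= 1], and the [1 / q ^ j] add up to at most [1 / (q - 1)], the
    1/4 can be shared out as [(q - 1) / 4] per level. *)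
Lemma distort Q q G W B :
  prime q -> coprime Q q -> (0 < Q)%N -> (forall x, 0 <= W x) -> avoids Q W ->
  (forall rho, \sum_(x < Q) W x * pos (hits R Q rho x - (q%:R - 1) / 4) <= B) ->
  exists g : nat -> nat -> R,
  [/\ forall x t, 0 <= g x t <= 4 / 3 / (q ^ G)%:R,
      forall x, \sum_(t < q ^ G) g x t <= 1,
      avoids (Q * q ^ G) (lift_weight Q W g) &
      \sum_(x < Q) W x - 4 / 3 * B / (q%:R - 1) <=
      \sum_(x < Q * q ^ G) lift_weight Q W g x].
Proof.
move=> pq coQ Q0 W0 avW leB; have q0 := prime_gt0 pq; have q1 := prime_gt1 pq.
have Qq0 : (0 < Q * q ^ G)%N by rewrite muln_gt0 Q0 expn_gt0 q0.
have a1 : 1 < q%:R :> R by rewrite ltr1n.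
have qG0 : 0 < (q ^ G)%:R :> R by rewrite ltr0n expn_gt0 q0.
(* All moduli divisible by [q] are removed here, including those below [K]. *)
pose bad x t := has (fun d => (q %| d)%N && (x + t * Q == r d %[mod d])) (divisors (Q * q ^ G)).
pose alpha x : R := \sum_(t < q ^ G) (bad x t)%:R / (q ^ G)%:R.
have alpha_le1 x : alpha x <= 1.
  rewrite /alpha -mulr_suml ler_pdivrMr // mul1r.
  apply: (@le_trans _ _ (\sum_(t < q ^ G) 1)); last by rewrite sumr_const card_ord.
  by apply: ler_sum => t _; case: (bad x t).
(* The comparison is multiplied out so that [alpha x = 1] falls in the capped case. *)
pose c x : R := if (1 - alpha x) * (4 / 3) <= 1 then 4 / 3 else (1 - alpha x)^-1.
have c_bounds x : 0 <= c x <= 4 / 3.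
  rewrite /c; case: ifP => [_|/negbT]; first lra.
  have := alpha_le1 x; rewrite -ltNge => ? ?.
  have al : 0 < 1 - alpha x by lra.
  rewrite invr_ge0 (ltW al) /= -[leLHS]mul1r ler_pdivrMr //; lra.
pose g x t : R := if bad x t then 0 else c x / (q ^ G)%:R.
have sum_g x : \sum_(t < q ^ G) g x t = c x * (1 - alpha x).
  have -> : 1 - alpha x = \sum_(t < q ^ G) (1 - (bad x t)%:R) / (q ^ G)%:R.
    under eq_bigr do rewrite mulrBl mul1r.
    by rewrite sumrB sumr_const card_ord -[_ *+ _]mulr_natr mulVf ?lt0r_neq0.
  rewrite mulr_sumr; apply: eq_bigr => t _; rewrite /g.
  by case: (bad x t); rewrite ?subrr ?mul0r ?mulr0 // subr0 mul1r.
have g0 x t : 0 <= g x t <= 4 / 3 / (q ^ G)%:R.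
  have /andP[c0 c43] := c_bounds x; rewrite /g; case: ifP => _.
    by rewrite lexx divr_ge0 //=; lra.
  by rewrite divr_ge0 //= ler_wpM2r // invr_ge0 ltW.
pose n j x := hits R Q (fun m => r (m * q ^ j)%N) x.
have alpha_le x : alpha x <= \sum_(j < G) n j.+1 x / q%:R ^+ j.+1.
  (* A union bound over the moduli, then [mean_fibre_hits] for the uniform fibre weight, with
     [u = 1]. *)
  pose w (x t : nat) : R := (q ^ G)%:R^-1.
  have w0 (y t : nat) : 0 <= w y t <= 1 / (q ^ G)%:R by rewrite mul1r lexx invr_ge0 ltW.
  have w1 (y : nat) : \sum_(t < q ^ G) w y t <= 1.
    by rewrite sumr_const card_ord -[_ *+ _]mulr_natr mulVf ?lt0r_neq0.
  apply: (@le_trans _ _ (\sum_(t < q ^ G) w x t * \sum_(j < G) fibre_hits R Q q r j.+1 x t)).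
    apply: ler_sum => t _; rewrite mulrC; apply: ler_wpM2l; first by rewrite invr_ge0 ltW.
    have h0 d : 0 <= ((q %| d)%N && (x + t * Q == r d %[mod d]))%:R :> R by [].
    apply: (@le_trans _ _ (\sum_(d <- divisors (Q * q ^ G))
        ((q %| d)%N && (x + t * Q == r d %[mod d]))%:R)).
      rewrite /bad; elim: (divisors _) => [|d s IH]; first by rewrite big_nil.
      rewrite big_cons /=; case: (_ && _) => /=; last by rewrite add0r.
      by rewrite lerDl sumr_ge0.
    rewrite big_divisors_mul // big_ord_recl /= big_seq big1 ?add0r; last first.
      move=> m; rewrite -dvdn_divisors // => mQ; rewrite muln1.
      have := coprime_dvdl mQ coQ; rewrite coprime_sym prime_coprime //.
      by move=> /negbTE->.
    apply: ler_sum => j _; rewrite big_seq [leRHS]big_seq; apply: ler_sum => m.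
    rewrite -dvdn_divisors // /bump /= add1n => mQ.
    have co : coprime m (q ^ j.+1) by rewrite coprimeXr // (coprime_dvdl mQ).
    rewrite chinese_remainder // dvdn_mull ?dvdn_exp //=.
    have -> : (x + t * Q == r (m * q ^ j.+1)%N %[mod m]) = (x == r (m * q ^ j.+1)%N %[mod m]).
      by case/dvdnP: mQ => k ->; rewrite mulnA addnC modnMDl.
    by rewrite -mulnb natrM.
  under eq_bigr do rewrite mulr_sumr; rewrite exchange_big /=.
  apply: ler_sum => j _.
  apply: le_trans (mean_fibre_hits pq coQ Q0 w0 w1 r x (j := j.+1) _) _; first by rewrite ltnS.
  by rewrite /= ltn_ord mul1r natrX mulrC.
have loss x : 1 - \sum_(t < q ^ G) g x t <=
    \sum_(j < G) 4 / 3 / q%:R ^+ j.+1 * pos (n j.+1 x - (q%:R - 1) / 4).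
  have pos0 (j : nat) : 0 <= 4 / 3 / q%:R ^+ j.+1 * pos (n j.+1 x - (q%:R - 1) / 4).
    by rewrite mulr_ge0 ?pos_ge0 // divr_ge0 ?exprn_ge0 //; lra.
  rewrite sum_g /c; case: ifP => [_|/negbT]; last first.
    rewrite -ltNge => h; rewrite mulVf ?subrr ?sumr_ge0 //.
    by apply/negP => /eqP h0; move: h; rewrite h0 mul0r ltr10.
  apply: (@le_trans _ _ (\sum_(j < G) 4 / 3 / q%:R ^+ j.+1 * (n j.+1 x - (q%:R - 1) / 4))).
    have -> : \sum_(j < G) 4 / 3 / q%:R ^+ j.+1 * (n j.+1 x - (q%:R - 1) / 4) =
       4 / 3 * \sum_(j < G) n j.+1 x / q%:R ^+ j.+1 -
       (q%:R - 1) / 3 * \sum_(j < G) 1 / q%:R ^+ j.+1.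
      rewrite !mulr_sumr -sumrB; apply: eq_bigr => j _; field.
      by rewrite expf_neq0 //; lra.
    have geo := @geom_sum_le R q 1 q1 ler01 G.
    have a0 : 0 <= (q%:R - 1) / 3 :> R by lra.
    have := ler_wpM2l a0 geo; have -> : (q%:R - 1) / 3 * (1 / (q%:R - 1)) = 1 / 3 :> R.
      by field; lra.
    have := alpha_le x; lra.
  apply: ler_sum => j _; apply: ler_wpM2l; last exact: pos_ge.
  by rewrite divr_ge0 ?exprn_ge0 //; lra.
have B0 : 0 <= B.
  by apply: le_trans (leB r); apply: sumr_ge0 => x _; rewrite mulr_ge0 ?pos_ge0.
exists g; split=> //.
- move=> x; rewrite sum_g /c; case: ifP => [|/negbT]; first by lra.
  by rewrite -ltNge => h; rewrite mulVf // lt0r_neq0 //; lra.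
- move=> x xQ; rewrite /lift_weight mulf_eq0 negb_or => /andP[Wx gx] d dQ Kd.
  apply/negP => xd; have [qd|qd] := boolP (q %| d)%N.
    move: gx; rewrite /g ifT ?eqxx //; apply/hasP; exists d; first by rewrite -dvdn_divisors.
    by rewrite qd addnC -divn_eq.
  have dvQ : (d %| Q)%N.
    by rewrite -(@Gauss_dvdl _ _ (q ^ G)) // coprimeXr // coprime_sym prime_coprime.
  have := avW (x %% Q)%N (ltn_pmod _ Q0) Wx d dvQ Kd.
  by rewrite modn_dvdm // xd.
have -> : \sum_(x < Q * q ^ G) lift_weight Q W g x = \sum_(x < Q) W x * \sum_(t < q ^ G) g x t.
  have := sum_lift q G W g Q0 (fun=> 1); under eq_bigr do rewrite mulr1.
  by move=> ->; apply: eq_bigr => x _; congr (_ * _); apply: eq_bigr => t _; rewrite mulr1.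
rewrite lerBlDr addrC -lerBlDr -sumrB.
apply: (@le_trans _ _ (\sum_(x < Q) \sum_(j < G)
    4 / 3 / q%:R ^+ j.+1 * (W x * pos (n j.+1 x - (q%:R - 1) / 4)))).
  apply: ler_sum => x _; rewrite -{1}[W x]mulr1 -mulrBr.
  apply: le_trans (ler_wpM2l (W0 x) (loss x)) _; rewrite mulr_sumr.
  by apply: ler_sum => j _; rewrite mulrCA.
rewrite exchange_big /=; apply: (@le_trans _ _ (\sum_(j < G) 4 / 3 / q%:R ^+ j.+1 * B)).
  apply: ler_sum => j _; rewrite -mulr_sumr; apply: ler_wpM2l.
    by rewrite divr_ge0 ?exprn_ge0 //; lra.
  exact: leB.
rewrite -mulr_suml mulrAC; apply: ler_wpM2r => //.
by apply: geom_sum_le => //; lra.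
Qed.

End Distortion.

(** * Weights along the primes *)

Section Stages.
Variable R : realFieldType.
Variables (r : nat -> nat) (K G : nat).
Implicit Types (D E F u m Dm S : R) (W : nat -> R) (mu : seq (nat * R)) (b q : nat).

(* The exponent [G] is a fixed large number, so that every modulus in question
   divides [smooth_part b] for some [b]. *)
Definition smooth_part b : nat := (\prod_(p < b | prime p) p ^ G)%N.
Local Notation P := smooth_part.

Lemma smooth_part_gt0 b : (0 < P b)%N.
Proof. by apply: prodn_cond_gt0 => p /prime_gt0 p0; rewrite expn_gt0 p0. Qed.

Lemma smooth_partS b : P b.+1 = if prime b then (P b * b ^ G)%N else P b.
Proof. by rewrite /P big_mkcond big_ord_recr -big_mkcond /=; case: ifP; rewrite ?muln1. Qed.

Lemma smooth_part_coprime b : prime b -> coprime (P b) b.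
Proof.
move=> pb; apply: (big_rec (fun x => coprime x b)) => [|p x pp co].
  exact: coprime1n.
rewrite coprimeMl co andbT coprimeXl // prime_coprime //.
by rewrite dvdn_prime2 // neq_ltn ltn_ord.
Qed.

(** If [p ^ v] divides [d], then [v < p ^ v <= d < b <= G]. *)
Lemma dvdn_smooth_part b d : (0 < d < b)%N -> (b <= G)%N -> (d %| P b)%N.
Proof.
move=> /andP[d0 db] bG; apply/dvdn_partP => // p; rewrite mem_primes => /and3P[pp _ pd].
have pb : (p < b)%N by apply: leq_ltn_trans (dvdn_leq d0 pd) db.
rewrite p_part /P (bigD1 (Ordinal pb)) //= dvdn_mulr // dvdn_exp2l //.
apply: leq_trans bG; apply: ltnW; apply: leq_ltn_trans db.
apply: leq_trans (ltnW (ltn_expl _ (prime_gt1 pp))) (dvdn_leq d0 _).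
exact: pfactor_dvdnn.
Qed.

Definition nonneg_mass mu := forall z, z \in mu -> 0 <= z.2.

(* [mu'] accounts for the law of [tau * (v + 1)], where [v] is at least [i + 1]
   with probability [t i] and at most [V]; lowering these probabilities
   only weakens the bound. *)
Definition spread_below Dm q u mu mu' := exists V (t : nat -> R),
  [/\ (V <= G)%N, forall v, (v < V)%N -> t v <= u / (q ^ v.+1)%:R &
  forall D, 0 <= D <= Dm ->
    below mu 1 D - \sum_(v < V) t v * (below mu v.+1 D - below mu v.+2 D)
      <= below mu' 1 D].

(** The last clause is the mean number of progressions through a uniform point; [remove_smooth]
    turns it into a bound on the sum over moduli at least [K]. *)
Definition uniform_stage Dm b E mu F :=
  [/\ nonneg_mass mu, tail_bound (P b) (fun=> (P b)%:R^-1) Dm E mu,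
    square_bound (P b) (fun=> (P b)%:R^-1) F &
    \sum_(d <- divisors (P b)) d%:R^-1 <= E].

Definition distorted_stage Dm b m E mu F := nonneg_mass mu /\ exists W,
  [/\ forall x, 0 <= W x, avoids r K (P b) W, m <= \sum_(x < P b) W x,
     tail_bound (P b) W Dm E mu & square_bound (P b) W F].

Definition square_stage b m F := exists W,
  [/\ forall x, 0 <= W x, avoids r K (P b) W, m <= \sum_(x < P b) W x &
     square_bound (P b) W F].

Lemma uniform_stage0 Dm : uniform_stage Dm 0 1 [:: (1%N, 1)] 1.
Proof.
have P0 : P 0 = 1%N by rewrite /P big_ord0.
have h1 rho : hits R 1 rho 0 = 1 by rewrite /hits big_seq1 !modn1.
rewrite /uniform_stage P0; split.
- by move=> z; rewrite inE => /eqP->.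
- move=> rho D _; rewrite big_ord1 h1 invr1 mul1r /below big_seq1 /= mul1n mul1r.
  by apply: pos_le; have := pos_ge (D - 1); have := pos_ge0 (D - 1); lra.
- by move=> rho; rewrite big_ord1 h1 invr1 mul1r expr1n.
- by rewrite big_seq1 invr1.
Qed.

(** Uniform weight lifts to uniform weight through constant fibre weights, whose density bound is
    1. *)
Lemma uniform_stage_prime Dm q E mu F E' mu' F' :
  prime q -> 0 <= Dm -> uniform_stage Dm q E mu F -> nonneg_mass mu' ->
  spread_below Dm q 1 mu mu' ->
  E * (1 + 1 / (q%:R - 1)) <= E' ->
  F * (1 + 1 * (3 * q%:R - 1) / (q%:R - 1) ^+ 2) <= F' ->
  uniform_stage Dm q.+1 E' mu' F'.
Proof.
move=> pq Dm0 [mu0 tb sb sumE] mu'0 [V [t [VG tV spread]]] leE leF.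
have q0 := prime_gt0 pq; have coQ := smooth_part_coprime pq.
have Q0 := smooth_part_gt0 q.
set W := fun _ : nat => _ in tb sb.
have W0 x : 0 <= W x by rewrite invr_ge0.
pose w (_ _ : nat) : R := (q ^ G)%:R^-1.
have w0 (y z : nat) : 0 <= w y z <= 1 / (q ^ G)%:R by rewrite mul1r lexx invr_ge0 ler0n.
have w1 (y : nat) : \sum_(z < q ^ G) w y z <= 1.
  by rewrite sumr_const card_ord -[_ *+ _]mulr_natr mulVf // pnatr_eq0 expn_eq0 negb_and -lt0n q0.
have lW x : lift_weight (P q) W w x = (P q * q ^ G)%:R^-1.
  by rewrite /lift_weight /W /w natrM invfM.
rewrite /uniform_stage smooth_partS pq; split=> //.
- move=> rho D DD; under eq_bigr => x _ do rewrite -(lW x).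
  apply: le_trans (tail_bound_lift pq coQ Q0 W0 w0 w1 _ _ VG mu0 tV tb DD) _.
    by rewrite ler1n.
  by apply: lerD; [rewrite lerD2r | apply: spread].
- move=> rho; under eq_bigr => x _ do rewrite -(lW x).
  exact: le_trans (square_bound_lift pq coQ Q0 W0 w0 w1 sb rho) leF.
have E0 : 0 <= E.
  by apply: le_trans sumE; apply: sumr_ge0 => d _; rewrite invr_ge0.
rewrite big_divisors_mul //; apply: le_trans leE; rewrite big_ord_recl.
under eq_bigr do rewrite muln1.
rewrite mulrDr mulr1; apply: lerD => //.
apply: le_trans (ler_wpM2l E0 (@geom_sum_le R q 1 (prime_gt1 pq) ler01 G)).
rewrite mulr_sumr; apply: ler_sum => j _; rewrite mul1r.
under eq_bigr do rewrite natrM invfM natrX.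
by rewrite -mulr_suml ler_wpM2r // invr_ge0 exprn_ge0.
Qed.

Lemma uniform_stage_next Dm b E mu F : ~~ prime b ->
  uniform_stage Dm b E mu F -> uniform_stage Dm b.+1 E mu F.
Proof. by move=> /negbTE npb; rewrite /uniform_stage smooth_partS npb. Qed.

Lemma sum_residue_le Q d a : (d %| Q)%N -> (0 < Q)%N ->
  \sum_(x < Q) (x == a %[mod d])%:R <= Q%:R / d%:R :> R.
Proof.
move=> /dvdnP[k ->]; rewrite mulnC muln_gt0 => /andP[d0 k0].
rewrite (sum_fibres (fun x => (x == a %[mod d])%:R)) exchange_big /=.
rewrite natrM mulrAC divff ?mul1r ?pnatr_eq0 -?lt0n //.
rewrite -[k in leRHS]card_ord -sumr_const; apply: ler_sum => t _.
apply: sum_le1 => i j /= /eqP ei /eqP ej; apply/val_inj.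
by move: ej; rewrite -ei ![(_ + t * d)%N]addnC !modnMDl !modn_small // => ->.
Qed.

(** Union bound: the removed mass is at most the sum of [1 / d] over [d >= K]. Lowering weights
    pointwise preserves the tail and square bounds. *)
Lemma remove_smooth Dm b E mu F S :
  uniform_stage Dm b E mu F ->
  S <= \sum_(d <- divisors (P b) | (d < K)%N) d%:R^-1 ->
  distorted_stage Dm b (1 - (E - S)) E mu F.
Proof.
move=> [mu0 tb sb sumE] leS; split=> //.
have Q0 := smooth_part_gt0 b; set Q := P b in tb sb sumE leS Q0 *.
pose bad x := has (fun d => (K <= d)%N && (x == r d %[mod d])) (divisors Q).
pose W x : R := if bad x then 0 else Q%:R^-1.
have W0 x : 0 <= W x by rewrite /W; case: ifP => // _; rewrite invr_ge0.
have WQ x : W x <= Q%:R^-1 by rewrite /W; case: ifP => // _; rewrite invr_ge0.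
exists W; split=> //.
- move=> x xQ; rewrite /W; case: ifP => [_|/negbT/hasPn badx _ d dQ Kd]; first by rewrite eqxx.
  by have := badx d; rewrite -dvdn_divisors // Kd => /(_ dQ).
- apply: (@le_trans _ _ (\sum_(x < Q) (Q%:R^-1 - \sum_(d <- divisors Q | (K <= d)%N)
      (x == r d %[mod d])%:R / Q%:R))).
    rewrite sumrB sumr_const card_ord -[_ *+ Q]mulr_natr mulVf ?pnatr_eq0 -?lt0n //.
    rewrite exchange_big /= lerD2l lerN2.
    apply: (@le_trans _ _ (\sum_(d <- divisors Q | (K <= d)%N) d%:R^-1)).
      rewrite big_seq_cond [leRHS]big_seq_cond; apply: ler_sum => d /andP[].
      rewrite -dvdn_divisors // => dQ _.
      rewrite -mulr_suml ler_pdivrMr ?ltr0n // mulrC; exact: sum_residue_le.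
    rewrite lerBrDr; apply: le_trans sumE; rewrite addrC [leRHS](bigID (fun d => d < K)%N) /=.
    by apply: lerD => //; rewrite le_eqVlt; apply/orP/or_introl/eqP/eq_bigl => d; rewrite -leqNgt.
  apply: ler_sum => x _; rewrite /W; case: ifP => [|_]; last first.
    by rewrite lerBlDr lerDl; apply: sumr_ge0 => d _; rewrite divr_ge0.
  move=> /hasP[d dQ /andP[Kd xd]]; rewrite subr_le0 big_mkcond (bigD1_seq d) ?divisors_uniq //=.
  rewrite Kd xd mul1r lerDl; apply: sumr_ge0 => k _.
  by case: ifP => // _; rewrite divr_ge0.
- move=> rho D DD; apply: le_trans (tb rho D DD).
  by apply: ler_sum => x _; apply: ler_wpM2r => //; apply: pos_ge0.
- move=> rho; apply: le_trans (sb rho).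
  by apply: ler_sum => x _; apply: ler_wpM2r => //; apply: sqr_ge0.
Qed.

Lemma distorted_stage_prime Dm q m E mu F m' E' mu' F' :
  prime q -> (q%:R - 1) / 4 <= Dm -> distorted_stage Dm q m E mu F ->
  nonneg_mass mu' -> spread_below Dm q (4 / 3) mu mu' ->
  m' <= m - 4 / 3 * (E - (q%:R - 1) / 4 + below mu 1 ((q%:R - 1) / 4)) / (q%:R - 1) ->
  E * (1 + 4 / 3 / (q%:R - 1)) <= E' ->
  F * (1 + 4 / 3 * (3 * q%:R - 1) / (q%:R - 1) ^+ 2) <= F' ->
  distorted_stage Dm q.+1 m' E' mu' F'.
Proof.
move=> pq qDm [mu0 [W [W0 avW mW tb sb]]] mu'0 [V [t [VG tV spread]]] lem leE leF.
split=> //; have q0 := prime_gt0 pq; have coQ := smooth_part_coprime pq.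
have Q0 := smooth_part_gt0 q.
have q1 : 2 <= q%:R :> R by rewrite ler_nat prime_gt1.
have D0 : 0 <= (q%:R - 1) / 4 :> R by lra.
have {}D0 : 0 <= (q%:R - 1) / (4 : R) <= Dm by rewrite D0 qDm.
have [g [g0 g1 avg mg]] := distort G pq coQ Q0 W0 avW (fun rho => tb rho _ D0).
exists (lift_weight (P q) W g); rewrite smooth_partS pq; split=> //.
- move=> x; rewrite mulr_ge0 //; by case/andP: (g0 (x %% P q)%N (x %/ P q)%N).
- by apply: le_trans lem _; apply: le_trans mg; rewrite lerD2r.
- move=> rho D DD.
  apply: le_trans (tail_bound_lift pq coQ Q0 W0 g0 g1 _ _ VG mu0 tV tb DD) _; first lra.
  by apply: lerD; [rewrite lerD2r | apply: spread].
- by move=> rho; exact: le_trans (square_bound_lift pq coQ Q0 W0 g0 g1 sb rho) leF.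
Qed.

Lemma distorted_stage_next Dm b m E mu F : ~~ prime b ->
  distorted_stage Dm b m E mu F -> distorted_stage Dm b.+1 m E mu F.
Proof. by move=> /negbTE npb; rewrite /distorted_stage smooth_partS npb. Qed.

Lemma distorted_square_stage Dm b m E mu F :
  distorted_stage Dm b m E mu F -> square_stage b m F.
Proof. by move=> [_ [W [? ? ? ? ?]]]; exists W; split. Qed.

Lemma square_stage_ge0 b m F : square_stage b m F -> 0 <= F.
Proof.
move=> [W [W0 _ _ sb]]; apply: le_trans (sb id).
by apply: sumr_ge0 => x _; rewrite mulr_ge0 ?sqr_ge0.
Qed.

Lemma square_stage_le b m F m' F' : m' <= m -> F <= F' ->
  square_stage b m F -> square_stage b m' F'.
Proof.
move=> lem leF [W [W0 avW mW sb]]; exists W; split=> //; first exact: le_trans mW.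
by move=> rho; apply: le_trans leF.
Qed.

Lemma square_stage_prime q m F : prime q -> square_stage q m F ->
  square_stage q.+1 (m - 4 / 3 * F / (q%:R - 1) ^+ 2)
    (F * (1 + 4 / 3 * (3 * q%:R - 1) / (q%:R - 1) ^+ 2)).
Proof.
move=> pq [W [W0 avW mW sb]].
have q0 := prime_gt0 pq; have coQ := smooth_part_coprime pq.
have Q0 := smooth_part_gt0 q.
have q1 : 2 <= q%:R :> R by rewrite ler_nat prime_gt1.
(* From [(h - (q - 1) / 2) ^ 2 >= 0] one gets [h - (q - 1) / 4 <= h ^ 2 / (q - 1)]. *)
have leB rho : \sum_(x < P q) W x * pos (hits R (P q) rho x - (q%:R - 1) / 4) <=
   F / (q%:R - 1).
  apply: (@le_trans _ _ (\sum_(x < P q) W x * hits R (P q) rho x ^+ 2 / (q%:R - 1))).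
    apply: ler_sum => x _; rewrite -mulrA; apply: ler_wpM2l => //.
    apply: pos_le; last by rewrite divr_ge0 ?sqr_ge0 //; lra.
    rewrite ler_pdivlMr; last lra.
    by have := sqr_ge0 (hits R (P q) rho x - (q%:R - 1) / 2); nra.
  by rewrite -mulr_suml ler_wpM2r // invr_ge0; lra.
have [g [g0 g1 avg mg]] := distort G pq coQ Q0 W0 avW leB.
exists (lift_weight (P q) W g); rewrite smooth_partS pq; split=> //.
- move=> x; rewrite mulr_ge0 //; by case/andP: (g0 (x %% P q)%N (x %/ P q)%N).
- apply: le_trans mg; rewrite [X in _ <= _ - X](_ : _ = 4 / 3 * F / (q%:R - 1) ^+ 2).
    by rewrite lerD2r.
  by field; lra.
- by move=> rho; exact: (square_bound_lift pq coQ Q0 W0 g0 g1 sb rho).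
Qed.

Lemma square_stage_next b m F : ~~ prime b -> square_stage b m F -> square_stage b.+1 m F.
Proof. by move=> /negbTE npb; rewrite /square_stage smooth_partS npb. Qed.

Lemma square_stage_uncovered b m F : (0 < K)%N -> (b <= G)%N -> 0 < m ->
  square_stage b m F -> exists x, forall d, (K <= d < b)%N -> x != r d %[mod d].
Proof.
move=> K0 bG m0 [W [W0 avW mW _]].
have [x Wx] : exists x : 'I_(P b), W x != 0.
  apply/existsP; apply: contraTT (lt_le_trans m0 mW) => /existsPn W00.
  by rewrite big1 ?ltxx // => x _; apply/eqP; have := W00 x; rewrite negbK.
exists x => d /andP[Kd db]; apply: avW => //.
by rewrite dvdn_smooth_part // db (leq_trans K0 Kd).
Qed.

End Stages.

(** * Large primes *)

Lemma prime_ndvd_fact p n : prime p -> (n < p)%N -> ~~ (p %| n`!)%N.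
Proof.
move=> pp; elim: n => [|n IH] np; first by rewrite fact0 Euclid_dvd1.
by rewrite factS Euclid_dvdM // negb_or IH ?(ltnW np) // gtnNdvd.
Qed.

Lemma prod_primes_dvd (s : seq nat) n : uniq s ->
  (forall p, p \in s -> prime p && (p %| n)%N) -> (\prod_(p <- s) p %| n)%N.
Proof.
elim: s => [|p s IH] /=; first by rewrite big_nil dvd1n.
move=> /andP[ps us] sn; rewrite big_cons.
have /andP[pp pn] := sn p (mem_head _ _).
have sn' q : q \in s -> prime q && (q %| n)%N by move=> qs; apply: sn; rewrite inE qs orbT.
rewrite Gauss_dvd ?pn ?IH // prime_coprime //.
have: all (fun q => prime q && (q != p)) s.
  apply/allP => q qs; case/andP: (sn' q qs) => -> _ /=.
  by apply: contraNneq ps => <-.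
elim: (s) => [|q t IHt] /=; first by rewrite big_nil Euclid_dvd1.
move=> /andP[/andP[pq qp] tp]; rewrite big_cons Euclid_dvdM // negb_or IHt // andbT.
by rewrite dvdn_prime2 // eq_sym.
Qed.

(* Chebyshev: the product of these primes divides [C(2^k.+1, 2^k)], which is at most [2 ^ 2^k.+1]. *)
Lemma count_primes_dyadic k : (1 < k)%N ->
  (k * \sum_(2 ^ k <= p < 2 ^ k.+1) prime p <= 2 ^ k.+1)%N.
Proof.
move=> k1; set n := (2 ^ k)%N; have n2 : (2 ^ k.+1 = n + n)%N by rewrite expnS mul2n addnn.
have n0 : (0 < n)%N by rewrite expn_gt0.
pose s := [seq p <- index_iota n (2 ^ k.+1) | prime p].
have -> : (\sum_(n <= p < 2 ^ k.+1) prime p = size s)%N.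
  rewrite size_filter -sum1_count [RHS]big_mkcond /=.
  by apply: eq_bigr => p _; case: (prime p).
rewrite -(@leq_exp2l 2) // expnM.
have sP p : p \in s -> [/\ prime p, (n < p)%N & (p <= n + n)%N].
  rewrite mem_filter mem_index_iota n2 => /and3P[pp np pn]; split=> //; last exact: ltnW.
  rewrite ltn_neqAle np andbT; apply: contraTneq pp => <-.
  rewrite /n -(prednK (ltnW k1)) expnS; apply/negP => /primeP[_ /(_ 2 (dvdn_mulr _ _))].
  move=> /(_ isT)/orP[//|/eqP e]; have : (2 ^ k.-1 = 1)%N by lia.
  by case: (k) k1 => [|[|j]] //= _; rewrite expnS; lia.
apply: (@leq_trans (\prod_(p <- s) p)%N).
  elim: (s) sP => [|p t IH] sP; first by rewrite big_nil.
  rewrite big_cons expnS; apply: leq_mul; last by apply: IH => q qt; apply: sP; rewrite inE qt orbT.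
  by have [_ /ltnW] := sP p (mem_head _ _).
apply: (@leq_trans 'C(n + n, n)); last first.
  rewrite n2 -[X in (_ <= X ^ _)%N](addn1 1) expnDn.
  have nn : (n < (n + n).+1)%N by lia.
  by rewrite (bigD1 (Ordinal nn)) //= !exp1n !muln1 leq_addr.
apply: dvdn_leq; first by rewrite bin_gt0 leq_addl.
apply: prod_primes_dvd; first by rewrite filter_uniq // iota_uniq.
move=> p /sP[pp np pn]; rewrite pp /=.
have := bin_fact (leq_addl n n); rewrite addnK => e.
have : (p %| (n + n)`!)%N by rewrite dvdn_fact // prime_gt0.
by rewrite -e !Euclid_dvdM // (negbTE (prime_ndvd_fact pp np)) !orbF.
Qed.

Section Tail.
Variable R : realFieldType.
Variables (r : nat -> nat) (K G : nat).
Implicit Types (m F : R).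
Local Notation stage := (square_stage r K G).

Lemma bernoulli (z : R) n : -1 <= z -> 1 + n%:R * z <= (1 + z) ^+ n.
Proof.
move=> z1; elim: n => [|n IH]; first by rewrite mul0r addr0.
rewrite exprS -natr1; have z0 : 0 <= 1 + z by lra.
apply: le_trans (ler_wpM2l z0 IH).
have : 0 <= n%:R :> R by []; have := sqr_ge0 z; rewrite expr2; nra.
Qed.

(** [(1 + z) ^ n * (1 - z) ^ n <= 1], and Bernoulli bounds the second factor below by
    [1 - n * z]. *)
Lemma exprD1_le (z : R) n : 0 <= z <= 1 -> n%:R * z < 1 ->
  (1 + z) ^+ n <= (1 - n%:R * z)^-1.
Proof.
move=> /andP[z0 z1] nz; rewrite -[leLHS]mulr1 -[leRHS]mul1r ler_pdivlMr ?subr_gt0 //.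
rewrite mulr1; apply: (@le_trans _ _ ((1 + z) ^+ n * (1 - z) ^+ n)).
  apply: ler_wpM2l; first by rewrite exprn_ge0 //; lra.
  by have := @bernoulli (- z) n; rewrite mulrN; apply; lra.
rewrite -exprMn; apply: exprn_ile1; have := sqr_ge0 z; rewrite expr2; nra.
Qed.

Definition rate (a : nat) : R := 4 / 3 * (3 * a%:R - 1) / (a%:R - 1) ^+ 2.

(* The loss at each prime is [rate a * F / (3 * a - 1)], so that
   [m + F / (3 * a - 1)] does not change along a block. *)
Lemma square_stage_block a m F i : (1 < a)%N -> stage a m F ->
  let F' := F * (1 + rate a) ^+ (\sum_(a <= p < a + i) prime p) in
  stage (a + i) (m - (F' - F) / (3 * a%:R - 1)) F'.
Proof.
move=> a1 st /=; have a2 : 2 <= a%:R :> R by rewrite ler_nat.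
elim: i => [|i IH]; first by rewrite addn0 big_geq // expr0 mulr1 subrr mul0r subr0.
rewrite addnS big_nat_recr ?leq_addr //=.
case: (boolP (prime (a + i))) => [pi|npi]; last first.
  by rewrite addn0; apply: square_stage_next.
rewrite addn1; move: IH; set F1 := F * _; move=> IH.
have F1ge0 := square_stage_ge0 IH.
have {IH} st1 := square_stage_prime pi IH; move: st1.
have -> : F * (1 + rate a) ^+ (\sum_(a <= p < a + i) prime p).+1 = F1 * (1 + rate a).
  by rewrite exprSr mulrA.
set q : R := (a + i)%:R; have aq : a%:R <= q by rewrite ler_nat leq_addr.
have inv_le : (q - 1)^-1 <= (a%:R - 1)^-1 by rewrite lef_pV2 ?posrE; lra.
have inv0 : 0 <= (q - 1)^-1 by rewrite invr_ge0; lra.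
have inv2 : (q - 1)^-1 ^+ 2 <= (a%:R - 1)^-1 ^+ 2 by rewrite lerXn2r // nnegrE; lra.
apply: square_stage_le; last first.
  apply: ler_wpM2l => //; rewrite lerD2l /rate.
  (* Partial fractions show that the rate decreases with the prime, so the rate at [a] serves the
     whole block. *)
  have -> : 4 / 3 * (3 * q - 1) / (q - 1) ^+ 2 =
    4 * (q - 1)^-1 + 8 / 3 * (q - 1)^-1 ^+ 2 by field; lra.
  have -> : 4 / 3 * (3 * a%:R - 1) / (a%:R - 1) ^+ 2 =
    4 * (a%:R - 1)^-1 + 8 / 3 * (a%:R - 1)^-1 ^+ 2 :> R by field; lra.
  lra.
have -> : m - (F1 * (1 + rate a) - F) / (3 * a%:R - 1) =
   m - (F1 - F) / (3 * a%:R - 1) - 4 / 3 * F1 * (a%:R - 1)^-1 ^+ 2.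
  by rewrite /rate; field; apply/andP; split; lra.
by rewrite lerD2l lerN2 -exprVn ler_wpM2l // mulr_ge0 //; lra.
Qed.

(** Five squarings, each rounded up to a small fraction. *)
Lemma expr32_le (y : R) : 0 <= y <= 203 / 200 -> y ^+ 32 <= 81 / 50.
Proof.
have sq (x b c : R) : 0 <= x <= b -> b ^+ 2 <= c -> 0 <= x ^+ 2 <= c.
  move=> /andP[x0 xb] bc; rewrite exprn_ge0 //= (le_trans _ bc) //.
  by apply: lerXn2r; rewrite ?nnegrE // (le_trans x0).
move=> /(sq y _ (34 / 33)) y2.
have /(sq (y ^+ 2) _ (69 / 65)) y4 := y2 ltac:(lra).
have /(sq ((y ^+ 2) ^+ 2) _ (71 / 63)) y8 := y4 ltac:(lra).
have /(sq (((y ^+ 2) ^+ 2) ^+ 2) _ (47 / 37)) y16 := y8 ltac:(lra).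
have /(sq ((((y ^+ 2) ^+ 2) ^+ 2) ^+ 2) _ (81 / 50)) y32 := y16 ltac:(lra).
by have /andP[_] := y32 ltac:(lra); rewrite -!exprM.
Qed.

(** With [a = 2 ^ k], [n <= 2 * a / 17] and [a * rate <= 4.01] bound [n * rate] by about 0.472,
    whose exponential is below 1.62. The exponential is replaced by a 32nd power:
    [1 + rate <= (1 + rate / 32) ^ 32], and [(1 + rate / 32) ^ n <= 203 / 200]. *)
Lemma block_growth k n : (17 <= k)%N -> (k * n <= 2 ^ k.+1)%N ->
  (1 + rate (2 ^ k)) ^+ n <= 81 / 50.
Proof.
move=> k17 kn; set a : R := (2 ^ k)%:R.
have a_ge : 1024 <= a.
  by rewrite ler_nat (_ : 1024 = 2 ^ 10)%N // leq_exp2l // (leq_trans _ k17).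
have n_le : n%:R <= 2 * a / 17.
  rewrite ler_pdivlMr // /a -natrM -natrM ler_nat -expnS.
  by apply: leq_trans kn; rewrite mulnC leq_mul2r k17 orbT.
have rate_le : a * rate (2 ^ k) <= 401 / 100.
  rewrite /rate -/a.
  have -> : a * (4 / 3 * (3 * a - 1) / (a - 1) ^+ 2) = (4 * a ^+ 2 - 4 / 3 * a) / (a - 1) ^+ 2.
    by field; lra.
  rewrite ler_pdivrMr ?exprn_gt0 //; [nra | lra].
have rate0 : 0 <= rate (2 ^ k).
  by rewrite /rate -/a divr_ge0 ?exprn_ge0 // ?mulr_ge0 //; lra.
set z := rate (2 ^ k) / 32.
have z0 : 0 <= z by rewrite /z divr_ge0.
have nz : n%:R * z <= 3 / 203.
  have : n%:R * rate (2 ^ k) <= 2 * a / 17 * rate (2 ^ k) by apply: ler_wpM2r.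
  by rewrite /z; nra.
have z1 : z <= 1.
  by rewrite /z; nra.
apply: (@le_trans _ _ (((1 + z) ^+ n) ^+ 32)).
  have -> : ((1 + z) ^+ n) ^+ 32 = ((1 + z) ^+ 32) ^+ n by rewrite -!exprM (mulnC n).
  have z1' : -1 <= z by lra.
  have := bernoulli 32 z1'; have -> : 1 + 32%:R * z = 1 + rate (2 ^ k) by rewrite /z; field.
  by move=> le_z; apply: lerXn2r => //; rewrite nnegrE ?exprn_ge0 //; lra.
clear rate_le n_le a_ge rate0.
set y := (1 + z) ^+ n.
have y0 : 0 <= y by rewrite /y exprn_ge0 //; lra.
have y1 : y <= 203 / 200.
  apply: le_trans (exprD1_le _ _) _; [lra | lra |].
  rewrite -[leLHS]mul1r ler_pdivrMr; lra.
by apply: expr32_le; rewrite y0 y1.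
Qed.

(** Over the block [F] is multiplied by [c <= 81 / 50] and [m] drops by [(c - 1) * F / (3 * a - 1)].
    The constant 11/10 works because [11 / 10 * (1 - c / 2) >= 0.209] exceeds
    [(c - 1) / 3 <= 0.2067], with room for the [- 1]. *)
Lemma square_stage_double k m F : (17 <= k)%N -> stage (2 ^ k) m F ->
  11 / 10 * F / (2 ^ k)%:R < m ->
  exists m' F', stage (2 ^ k.+1) m' F' /\ 11 / 10 * F' / (2 ^ k.+1)%:R < m'.
Proof.
move=> k17 st mF; have k1 : (1 < k)%N by apply: leq_trans k17.
have a1 : (1 < 2 ^ k)%N by rewrite -{1}(expn0 2) ltn_exp2l // (ltnW k1).
have e : (2 ^ k.+1 = 2 ^ k + 2 ^ k)%N by rewrite expnS mul2n addnn.
have := square_stage_block (2 ^ k) a1 st; rewrite -e /= => st'.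
have := block_growth k17 (count_primes_dyadic k1).
set c := (1 + _) ^+ _ in st' *; move=> c_le.
exists (m - (F * c - F) / (3 * (2 ^ k)%:R - 1)), (F * c); split=> //.
have F0 := square_stage_ge0 st.
have a_ge : 1024 <= (2 ^ k)%:R :> R.
  by rewrite ler_nat (_ : 1024 = 2 ^ 10)%N // leq_exp2l // (leq_trans _ k17).
rewrite e natrD; clear e; move: ((2 ^ k)%:R : R) a_ge mF => a a_ge mF.
rewrite -subr_gt0 in mF; rewrite -subr_gt0.
apply: lt_le_trans mF _.
rewrite -subr_ge0.
have -> : m - (F * c - F) / (3 * a - 1) - 11 / 10 * (F * c) / (a + a) - (m - 11 / 10 * F / a) =
  F * ((11 / 10 * (1 - c / 2) * (3 * a - 1) - (c - 1) * a) / (a * (3 * a - 1))).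
  by field; apply/andP; split; lra.
by rewrite mulr_ge0 // divr_ge0 ?mulr_ge0 //; nra.
Qed.

End Tail.

(** * Computation *)

Section Computation.
Local Open Scope N_scope.

Definition cdiv (a b : N) : N := (a + (b - 1)) / b.

(* Weighted multisets, as lists of (key, weight) pairs sorted by key. *)
Fixpoint merge_mass (l1 : seq (N * N)) : seq (N * N) -> seq (N * N) :=
  match l1 with
  | [::] => fun l2 => l2
  | (n1, w1) :: t1 => fix aux l2 :=
    match l2 with
    | [::] => l1
    | (n2, w2) :: t2 => match N.compare n1 n2 with
      | Lt => (n1, w1) :: merge_mass t1 l2
      | Gt => (n2, w2) :: aux t2
      | Eq => (n1, w1 + w2) :: merge_mass t1 t2
      end
    end
  end.

(* Values of [tau] from 1000 on are dropped: no [D] exceeds 4000 / 4. *)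
Definition scale_mass (k c : N) (mu : seq (N * N)) : seq (N * N) :=
  foldr (fun z acc => let n := k * z.1 in
    if N.ltb n 1000 then (n, c * z.2) :: acc else acc) [::] mu.

Definition round_up (bits k : N) : N := N.shiftr (k + (N.shiftl 1 bits - 1)) bits.

(* The law of [v * tau], [v] truncated as in [spread_below]; the probabilities
   [ts] are multiples of [2 ^ -20], so that no mass is lost. *)
Fixpoint spread_mass (v t : N) (ts : seq N) (mu : seq (N * N)) : seq (N * N) :=
  match ts with
  | [::] => scale_mass v t mu
  | t' :: ts' => merge_mass (scale_mass v (t - t') mu) (spread_mass (v + 1) t' ts' mu)
  end.

(** After merging, the factor [2 ^ 20] is divided out once per key. Rounding up is safe since it
    only increases [below]. *)
Definition step_mass (ts : seq N) (mu : seq (N * N)) : seq (N * N) :=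
  map (fun z => (z.1, round_up 20 z.2)) (spread_mass 1 (2 ^ 20) ts mu).

(** The quotients are rounded down, as [spread_below] requires lower probabilities. *)
Fixpoint powers_inv (V : nat) (x p : N) : seq N :=
  match V with O => [::] | S V' => x / p :: powers_inv V' (x / p) p end.

(* How many powers of [p] are told apart; higher powers are paid for by the gap
   between [E] and the mean of the listed law. *)
Definition spread_depth (p : N) : nat :=
  if N.eqb p 2 then 9%nat else if N.eqb p 3 then 6%nat else
  if N.eqb p 5 then 4%nat else if N.ltb p 20 then 3%nat else 2%nat.

Definition unit_mass : N := 2 ^ 32.

(* A state holds the mean [E], the law of [tau] and the second moment, in units
   of [1 / unit_mass], rounded up. *)
Definition uniform_step (s : N * seq (N * N) * N) (p : N) :=
  let '(E, mu, F) := s in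
  (E + cdiv E (p - 1), step_mass (powers_inv (spread_depth p) (2 ^ 20) p) mu,
   F + cdiv (F * (3 * p - 1)) ((p - 1) * (p - 1))).

Definition small_primes : seq N := [:: 2; 3; 5; 7; 11; 13; 17; 19; 23; 29; 31;
  37; 41; 43; 47; 53; 59; 61; 67; 71; 73; 79; 83; 89; 97; 101; 103; 107; 109;
  113; 127; 131; 137; 139; 149; 151; 157; 163; 167; 173; 179; 181; 191; 193;
  197; 199].

Definition uniform_state := foldl uniform_step (unit_mass, [:: (1, unit_mass)], unit_mass) small_primes.

Definition modulus_bound : N := 616000.

(* Rounding up to 5 significant bits bounds the number of keys in the lower
   bound [smooth_mass] for the sum of [1 / d] over smooth [d < 616000]. *)
Definition coarsen (k : N) : N := let s := N.size k - 5 in N.shiftl (round_up s k) s.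

(** Keys are rounded up and weights down, so that the mass up to any bound is underestimated. *)
Definition push_prime (p : N) (A : seq (N * N)) : seq (N * N) :=
  foldr (fun z acc => let n := coarsen (p * z.1) in
    if N.ltb n modulus_bound then (n, z.2 / p) :: acc else acc) [::] A.

(** Horner's scheme for the factor [1 + 1 / p + ... + 1 / p ^ V], starting from [B = A]. *)
Fixpoint geometric_push (V : nat) (p : N) (A B : seq (N * N)) : seq (N * N) :=
  match V with O => B | S V' => geometric_push V' p A (merge_mass A (push_prime p B)) end.

Fixpoint count_powers (fuel : nat) (p q : N) : nat :=
  match fuel with
  | O => O
  | S f => if N.ltb q modulus_bound then S (count_powers f p (q * p)) else O
  end.

(** Weights are in units of [2 ^ -28]; [final_check] multiplies by [2 ^ 4] to match [unit_mass].
    Fuel 19 suffices since [2 ^ 19 < 616000 < 2 ^ 20]. *)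
Definition smooth_mass : seq (N * N) :=
  foldl (fun A p => geometric_push (count_powers 19 p p) p A A) [:: (1, 2 ^ 28)] small_primes.

Definition total_mass (A : seq (N * N)) : N :=
  foldl (fun a z => if N.ltb z.1 modulus_bound then a + z.2 else a) 0 A.

(* Position [i] of [sieve k] stands for the number [200 + i].  Here [c] counts
   down to the next multiple of [q + 1]. *)
Fixpoint mark_multiples (q c : nat) (l : seq bool) : seq bool :=
  match l with
  | [::] => [::]
  | b :: l' => match c with O => false :: mark_multiples q q l' | S c' => b :: mark_multiples q c' l' end
  end.

Fixpoint double_up (k : nat) (l : seq bool) : seq bool :=
  match k with O => l | S k' => double_up k' (l ++ l) end.

Definition sieve (k : nat) : seq bool :=
  foldl (fun l p => mark_multiples (N.to_nat (p - 1)) (N.to_nat ((p - 200 mod p) mod p)) l)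
    (double_up k [:: true]) small_primes.

(** Four times [below] at threshold [m / 4], which keeps everything integral. *)
Definition below_val (m : N) (mu : seq (N * N)) : N :=
  foldr (fun z acc => let n := 4 * z.1 in
    if N.ltb n m then (m - n) * z.2 + acc else acc) 0 mu.

(** The loss is [4 / 3 * (E - D + below) / (p - 1)] at [D = (p - 1) / 4], with numerator and
    denominator scaled to integers; truncated subtraction still gives an upper bound. The single
    probability [2 ^ 22 / (3 * p)] is [4 / (3 * p)] in units of [2 ^ -20]. *)
Definition distorted_step (s : N * N * seq (N * N) * N) (p : N) :=
  let '(loss, E, mu, F) := s in
  (loss + cdiv (4 * E + below_val (p - 1) mu - (p - 1) * unit_mass) (3 * (p - 1)),
   E + cdiv (4 * E) (3 * (p - 1)),
   step_mass [:: 2 ^ 22 / (3 * p)] mu,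
   F + cdiv (4 * (F * (3 * p - 1))) (3 * ((p - 1) * (p - 1)))).

Fixpoint distorted_run (l : seq bool) (n : N) s :=
  match l with
  | [::] => (s, l)
  | b :: l' => if N.ltb n 4000 then
      distorted_run l' (n + 1) (if b then distorted_step s n else s)
    else (s, l)
  end.

(** [T] accumulates [F / (n - 1) ^ 2]; the factor 4/3 of the loss is applied at the end. *)
Fixpoint square_run (l : seq bool) (n T F : N) :=
  match l with
  | [::] => (T, F)
  | b :: l' => if N.ltb n (2 ^ 17) then
      if b then
        let t := cdiv F ((n - 1) * (n - 1)) in
        square_run l' (n + 1) (T + t) (F + cdiv (4 * ((3 * n - 1) * t)) 3)
      else square_run l' (n + 1) T F
    else (T, F)
  end.

(* The term [11 F / (10 * 2 ^ 17)] pays for the primes from [2 ^ 17] on, see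
   [square_stage_double]. *)
Definition final_check : bool :=
  let '(EA, mu, FA) := uniform_state in
  let '(s, l) := distorted_run (sieve 17) 200 (0, EA, mu, FA) in
  let '(loss, E, mu', FB) := s in
  let '(T, F) := square_run l 4000 0 FB in
  N.ltb (EA + loss + cdiv (4 * T) 3 + cdiv (11 * F) (10 * 2 ^ 17))
        (unit_mass + 2 ^ 4 * total_mass smooth_mass).

Lemma final_checkP : final_check = true.
Proof. by vm_cast_no_check (erefl true). Qed.

End Computation.

(** * Fixed-point weights *)

Arguments round_up : simpl never.
Arguments coarsen : simpl never.
Arguments cdiv : simpl never.
Arguments N.sub : simpl never.
Arguments N.pow : simpl never.
Arguments N.mul : simpl never.
Arguments N.div : simpl never.

Section Specification.
Variable R : realFieldType.
Implicit Types (f : nat -> R) (mu l A B : seq (N * N)) (a b k p w : N).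

(* Locked, so that no conversion test unfolds a large numeral into unary. *)
Definition toR : N -> R := locked (fun n => (N.to_nat n)%:R).

Lemma toRE a : toR a = (N.to_nat a)%:R. Proof. by rewrite /toR -lock. Qed.
Lemma toR_ge0 a : 0 <= toR a. Proof. by rewrite toRE ler0n. Qed.
Lemma toRD a b : toR (a + b) = toR a + toR b.
Proof. by rewrite !toRE -natrD; congr (_%:R); lia. Qed.
Lemma toRM a b : toR (a * b) = toR a * toR b.
Proof. by rewrite !toRE -natrM; congr (_%:R); lia. Qed.
Lemma toR_le a b : (a <= b)%num -> toR a <= toR b.
Proof. by move=> ab; rewrite !toRE ler_nat; lia. Qed.
Lemma toRB_ge a b : toR a - toR b <= toR (a - b).
Proof. by rewrite lerBlDr -toRD; apply: toR_le; lia. Qed.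
Lemma toRB a b : toR (a - b) = pos (toR a - toR b).
Proof.
case: (N.le_gt_cases b a) => ab; last first.
  rewrite pos_eq0; first by rewrite toRE (_ : N.to_nat (a - b) = 0%N) //; lia.
  by rewrite subr_le0; apply: toR_le; lia.
by rewrite -{2}(N.sub_add _ _ ab) toRD addrK pos_id ?toR_ge0.
Qed.
Lemma toR_gt0 a : (0 < a)%num -> 0 < toR a.
Proof. by move=> a0; rewrite toRE ltr0n; lia. Qed.

Lemma toR_pred p : (0 < p)%num -> toR (p - 1) = toR p - 1.
Proof.
move=> p0; rewrite toRB pos_id ?(toRE 1) // subr_ge0 -(toRE 1).
by apply: toR_le; lia.
Qed.

Lemma cdiv_ge a b : (0 < b)%num -> (a <= b * cdiv a b)%num.
Proof.
move=> b0; rewrite /cdiv.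
have := N.div_mod' (a + (b - 1)) b; have := N.mod_lt (a + (b - 1)) b; lia.
Qed.

Lemma toR_cdiv a b : (0 < b)%num -> toR a / toR b <= toR (cdiv a b).
Proof.
move=> b0; rewrite ler_pdivrMr ?toR_gt0 // -toRM; apply: toR_le.
by rewrite N.mul_comm; apply: cdiv_ge.
Qed.

Lemma toR_div a b : (0 < b)%num -> toR (a / b) <= toR a / toR b.
Proof.
move=> b0; rewrite ler_pdivlMr ?toR_gt0 // -toRM; apply: toR_le.
by rewrite N.mul_comm; apply: N.Div0.mul_div_le.
Qed.

Lemma round_up_ge s k : (k <= 2 ^ s * round_up s k)%num.
Proof.
rewrite /round_up N.shiftr_div_pow2 N.shiftl_1_l.
have s0 : (0 < 2 ^ s)%num by have := N.pow_nonzero 2 s; lia.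
exact: (cdiv_ge s0).
Qed.

Lemma coarsen_ge k : (k <= coarsen k)%num.
Proof.
by rewrite /coarsen N.shiftl_mul_pow2 N.mul_comm; apply: round_up_ge.
Qed.

Definition mass f mu : R := \sum_(z <- mu) toR z.2 * f (N.to_nat z.1).

Lemma mass_cons f z mu : mass f (z :: mu) = toR z.2 * f (N.to_nat z.1) + mass f mu.
Proof. by rewrite /mass big_cons. Qed.

Lemma mass_merge_mass f l1 l2 : mass f (merge_mass l1 l2) = mass f l1 + mass f l2.
Proof.
elim: l1 l2 => [|[n1 w1] t1 IH1] l2; first by rewrite /mass big_nil add0r.
elim: l2 => [|[n2 w2] t2 IH2] /=; first by rewrite [mass f [::]]/mass big_nil addr0.
case: N.compare_spec => [e|_|_].
- by rewrite !mass_cons IH1 /= toRD e mulrDl; ring.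
- by rewrite !mass_cons IH1 mass_cons addrA.
- by rewrite (mass_cons _ _ t2) mass_cons IH2 addrCA.
Qed.

Lemma mass_ge0 f mu : (forall n, 0 <= f n) -> 0 <= mass f mu.
Proof. by move=> f0; apply: sumr_ge0 => z _; rewrite mulr_ge0 ?toR_ge0 ?f0. Qed.

Lemma mass_scale_mass f v c mu : (forall n, (1000 <= n)%N -> f n = 0) ->
  mass f (scale_mass v c mu) = toR c * mass (fun n => f (N.to_nat v * n)%N) mu.
Proof.
move=> f1000; elim: mu => [|[n w] mu IH]; first by rewrite /mass !big_nil mulr0.
rewrite /= [in RHS]mass_cons /= mulrDr -IH.
case: N.ltb_spec => vn; first by rewrite mass_cons /= toRM mulrA N2Nat.inj_mul.
by rewrite f1000 ?mulr0 ?add0r //; move: vn; lia.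
Qed.

(** The copy scaled by [v + i] has as weight the difference of two consecutive probabilities;
    summation by parts gives the left side. Truncated subtraction can only add mass. *)
Lemma mass_spread f v t ts mu (K : nat -> R) : (forall n, 0 <= f n) ->
  (forall n, (1000 <= n)%N -> f n = 0) ->
  (forall i, K i = mass (fun n => f ((N.to_nat v + i) * n)%N) mu) ->
  toR t * K 0 - \sum_(i < size ts) toR (nth 0%num ts i) * (K i - K i.+1) <=
  mass f (spread_mass v t ts mu).
Proof.
move=> f0 f1000; elim: ts v t K => [|t' ts IH] v t K KE.
  by rewrite big_ord0 subr0 /= mass_scale_mass // KE addn0.
rewrite big_ord_recl /= mass_merge_mass mass_scale_mass //.
have K0 : 0 <= K 0 by rewrite KE; apply: mass_ge0 => n; apply: f0.
have -> : mass (fun n => f (N.to_nat v * n)%N) mu = K 0 by rewrite KE addn0.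
have := IH (v + 1)%num t' (fun i => K i.+1); rewrite /= => {}IH.
have {}IH := IH (fun i => _); set s1 := \sum_(_ < _) _ in IH *.
have := ler_wpM2r K0 (toRB_ge t t').
have {}IH : toR t' * K 1%N - s1 <= mass f (spread_mass (v + 1) t' ts mu).
  by apply: IH => i; rewrite KE; congr (mass _ mu); rewrite (_ : (N.to_nat (v + 1) + i = N.to_nat v + i.+1)%N) //; lia.
lra.
Qed.

Definition real_mass mu : seq (nat * R) := [seq (N.to_nat z.1, toR z.2 / toR unit_mass) | z <- mu].

Lemma unit_mass_gt0 : 0 < toR unit_mass. Proof. by apply: toR_gt0. Qed.

Lemma nonneg_real_mass mu : nonneg_mass (real_mass mu).
Proof.
by move=> z /mapP[y _ ->] /=; rewrite divr_ge0 ?toR_ge0.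
Qed.

Lemma below_real_mass mu v D :
  below (real_mass mu) v D = mass (fun n => pos (D - (v * n)%:R)) mu / toR unit_mass.
Proof.
rewrite /below /mass big_map mulr_suml; apply: eq_bigr => z _ /=.
by rewrite mulrAC.
Qed.

(** For [D <= 1000] the positive part vanishes at the values dropped by [scale_mass], so the
    truncation is exact. *)
Lemma spread_step_mass G q u ts mu : (size ts <= G)%N ->
  (forall i, (i < size ts)%N -> toR (nth 0%num ts i) / toR (2 ^ 20) <= u / (q ^ i.+1)%:R) ->
  spread_below G 1000%:R q u (real_mass mu) (real_mass (step_mass ts mu)).
Proof.
move=> szG le_ts; exists (size ts), (fun i => toR (nth 0%num ts i) / toR (2 ^ 20)).
split=> // D /andP[D0 D1000]; pose f n := pos (D - n%:R).
have f0 n : 0 <= f n by apply: pos_ge0.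
have f1000 n : (1000 <= n)%N -> f n = 0.
  by move=> n1000; apply: pos_eq0; rewrite subr_le0 (le_trans D1000) // ler_nat.
pose K i := mass (fun n => pos (D - (i.+1 * n)%:R)) mu.
have spr := @mass_spread f 1%num (2 ^ 20)%num ts mu K f0 f1000 (fun i => erefl).

have c0 : 0 < toR (2 ^ 20) by apply: toR_gt0.
have norm : mass f (spread_mass 1 (2 ^ 20) ts mu) <= toR (2 ^ 20) * mass f (step_mass ts mu).
  rewrite /mass /step_mass big_map mulr_sumr; apply: ler_sum => z _ /=.
  by rewrite mulrA; apply: ler_wpM2r => //; rewrite -toRM; apply/toR_le/round_up_ge.
rewrite !below_real_mass; under eq_bigr do rewrite !below_real_mass.
have -> : mass (fun n => pos (D - (1 * n)%:R)) (step_mass ts mu) = mass f (step_mass ts mu).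
  by apply: eq_bigr => z _; rewrite mul1n.
rewrite -/(K 0) -(ler_pM2r unit_mass_gt0) divfK ?lt0r_neq0 ?unit_mass_gt0 // -(ler_pM2l c0).
apply: le_trans norm; apply: le_trans spr.
rewrite mulrBl divfK ?lt0r_neq0 ?unit_mass_gt0 // mulrBr lerB // mulr_suml mulr_sumr.
rewrite le_eqVlt; apply/orP; left; apply/eqP; apply: eq_bigr => i _.
rewrite -/(K i) -/(K i.+1); field.
by rewrite !lt0r_neq0 ?unit_mass_gt0.
Qed.

Lemma mass_below_val m mu :
  toR (below_val m mu) = 4 * mass (fun n => pos (toR m / 4 - n%:R)) mu.
Proof.
elim: mu => [|[n w] mu IH]; first by rewrite /mass big_nil mulr0 toRE.
rewrite /= mass_cons mulrDr -IH.
have -> : 4 * (toR w * pos (toR m / 4 - (N.to_nat n)%:R)) = toR (m - 4 * n) * toR w.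
  rewrite toRB toRM mulrCA -posM // mulrC; congr (pos _ * _).
  rewrite (toRE 4) (toRE n) (_ : N.to_nat 4 = 4%N) //; lra.
case: N.ltb_spec => nm; first by rewrite /= toRD toRM.
by rewrite [toR (_ - _)]toRE (_ : N.to_nat (m - 4 * n) = 0%N) ?mul0r ?add0r //; lia.
Qed.
End Specification.

(** * Correctness of the computation *)

Section Runs.
Variable R : realFieldType.
Variables (r : nat -> nat) (K G : nat).
Hypothesis G19 : (19 <= G)%N.
Local Notation toR := (toR R).
Local Notation real_mass := (real_mass R).
Local Notation c := (toR unit_mass).
Local Notation P := (smooth_part G).
Implicit Types (a b E F T p t : N) (mu A B : seq (N * N)).

Let c0 : 0 < c. Proof. exact: unit_mass_gt0. Qed.

Lemma toR_prime p : prime (N.to_nat p) -> (1 < p)%num.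
Proof. by move/prime_gt1; lia. Qed.

Lemma fixed_point_le (x e : R) a b : 0 <= e -> x * e <= toR b ->
  toR a = x -> toR a / c * (1 + e) <= toR (a + b) / c.
Proof.
move=> e0 xe ax; rewrite mulrAC toRD; apply: ler_wpM2r; first by rewrite invr_ge0 ltW.
by rewrite mulrDr mulr1 lerD2l ax.
Qed.

Lemma size_powers_inv V x p : size (powers_inv V x p) = V.
Proof. by elim: V x => //= V IH x; rewrite IH. Qed.

Lemma nth_powers_inv V x p i : (0 < p)%num -> (i < V)%N ->
  toR (nth 0%num (powers_inv V x p) i) <= toR x / toR p ^+ i.+1.
Proof.
move=> p0; elim: V i x => [|V IH] [|i] x //= iV.
  by rewrite expr1; apply: toR_div.
apply: le_trans (IH _ _ iV) _; rewrite [_ ^+ i.+2]exprS invfM mulrA; apply: ler_wpM2r.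
  by rewrite invr_ge0 exprn_ge0 ?toR_ge0.
exact: toR_div.
Qed.

Definition uniform_ok n (s : N * seq (N * N) * N) :=
  let '(E, mu, F) := s in
  uniform_stage G 1000%:R n (toR E / c) (real_mass mu) (toR F / c).

Lemma uniform_ok_step p s : prime (N.to_nat p) ->
  uniform_ok (N.to_nat p) s -> uniform_ok (N.to_nat p).+1 (uniform_step s p).
Proof.
case: s => [[E mu] F] pp; have p1 := toR_prime pp.
have p0 : (0 < p)%num by lia.
have q1 : 1 < toR p by rewrite toRE ltr1n prime_gt1.
move=> st; apply: (uniform_stage_prime pp _ st); rewrite ?ler0n //.
- exact: nonneg_real_mass.
- apply: spread_step_mass; rewrite size_powers_inv.
    by apply: leq_trans G19; rewrite /spread_depth; do 4?case: ifP.
  move=> i iV; rewrite natrX -toRE.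
  have := nth_powers_inv (2 ^ 20) p0 iV; rewrite -(ler_pM2r (x := (toR (2 ^ 20))^-1)).
    move=> /le_trans; apply; rewrite mulrAC divff ?lexx //.
    by rewrite lt0r_neq0 // toR_gt0.
  by rewrite invr_gt0 toR_gt0.
- rewrite -toRE; apply: (fixed_point_le (x := toR E)) => //; first by rewrite divr_ge0 //; lra.
  rewrite mul1r; apply: le_trans (toR_cdiv _ _ _); last lia.
  by rewrite toR_pred.
- rewrite -toRE; apply: (fixed_point_le (x := toR F)) => //.
    by rewrite mul1r divr_ge0 ?exprn_ge0 //; lra.
  apply: le_trans (toR_cdiv _ _ _); last nia.
  have c3 : toR 3 = 3 by rewrite toRE (_ : N.to_nat 3 = 3%N).
  have e3 : toR (3 * p - 1) = 3 * toR p - 1 by rewrite toR_pred ?toRM ?c3 //; lia.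
  rewrite !toRM e3 toR_pred // le_eqVlt; apply/orP; left; apply/eqP; field; lra.
Qed.

Lemma uniform_ok_foldl n i l s :
  map N.to_nat l = [seq p <- iota n i | prime p] ->
  uniform_ok n s -> uniform_ok (n + i) (foldl uniform_step s l).
Proof.
elim: i n l s => [|i IH] n l s /=.
  by case: l => // _; rewrite addn0.
rewrite addnS -addSn; case: (boolP (prime n)) => pn; last first.
  move=> e ok; apply: IH => //; case: s ok => [[E mu] F]; exact: uniform_stage_next.
case: l => [|p l] //= [pn' e] ok; apply: IH => //.
by rewrite -pn'; apply: uniform_ok_step; rewrite pn'.
Qed.

(** Sums are compared up to every [x], since rounding keys up only lowers these cumulative sums. *)
Definition mass_upto A (x : nat) : R := \sum_(z <- A | (N.to_nat z.1 <= x)%N) toR z.2.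
Definition divisor_mass Q (x : nat) : R := \sum_(d <- divisors Q | (d <= x)%N) d%:R^-1.

Lemma mass_upto_merge A B x : mass_upto (merge_mass A B) x = mass_upto A x + mass_upto B x.
Proof.
have E l : mass_upto l x = mass (fun n => (n <= x)%N%:R : R) l.
  rewrite /mass_upto /mass big_mkcond; apply: eq_bigr => z _.
  by case: leqP; rewrite ?mulr1 ?mulr0.
by rewrite !E mass_merge_mass.
Qed.

(** A new key at most [x] comes from a [k] with [p * k <= x], that is [k <= x %/ p]. *)
Lemma mass_upto_push p A x : (0 < p)%num ->
  mass_upto (push_prime p A) x <= mass_upto A (x %/ N.to_nat p) / toR p.
Proof.
move=> p0; elim: A => [|[k w] A IH].
  by rewrite /mass_upto !big_nil mul0r.
have w0 : 0 <= toR w / toR p by rewrite divr_ge0 ?toR_ge0.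
have le_new : mass_upto ((coarsen (p * k)%num, (w / p)%num) :: push_prime p A) x <=
   mass_upto ((k, w) :: A) (x %/ N.to_nat p) / toR p.
  rewrite /mass_upto !big_cons /=; case: leqP => [kx|_]; last first.
    apply: le_trans IH _; apply: ler_wpM2r; first by rewrite invr_ge0 toR_ge0.
    by case: ifP => // _; rewrite lerDr toR_ge0.
  rewrite ifT; first by rewrite mulrDl; apply: lerD IH; apply: toR_div.
  rewrite leq_divRL; last lia.
  by apply: leq_trans kx; have := @coarsen_ge (p * k)%num; lia.
rewrite /=; case: N.ltb => //; apply: le_trans IH _.
apply: ler_wpM2r; first by rewrite invr_ge0 toR_ge0.
by rewrite /mass_upto big_cons; case: ifP => // _; rewrite lerDr toR_ge0.
Qed.

(** [B] already holds the terms up to exponent [i]; each push shifts them by one and [A] supplies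
    the term of exponent 0. *)
Lemma geometric_mass_upto p V i A B (h : nat -> R) : (0 < p)%num ->
  (forall x, mass_upto A x <= h x) ->
  (forall x, mass_upto B x <= \sum_(j < i.+1) h (x %/ N.to_nat p ^ j)%N / toR p ^+ j) ->
  forall x, mass_upto (geometric_push V p A B) x <=
    \sum_(j < (V + i).+1) h (x %/ N.to_nat p ^ j)%N / toR p ^+ j.
Proof.
move=> p0 leA; elim: V i B => [|V IH] i B leB x //=.
rewrite addSnnS; apply: IH => {}x; rewrite mass_upto_merge big_ord_recl.
apply: lerD; first by rewrite expr0 divr1 expn0 divn1.
apply: le_trans (mass_upto_push _ _ p0) _.
apply: le_trans (ler_wpM2r _ (leB _)) _; first by rewrite invr_ge0 toR_ge0.
rewrite mulr_suml; apply: ler_sum => j _ /=.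
by rewrite /bump /= add1n -divnMA -expnS exprS invfM mulrA mulrAC.
Qed.

Definition smooth_ok n A := forall x, mass_upto A x <= toR (2 ^ 28) * divisor_mass (P n) x.

Lemma divisor_mass_prime q x : prime q ->
  divisor_mass (P q.+1) x =
  \sum_(j < G.+1) divisor_mass (P q) (x %/ q ^ j)%N / q%:R ^+ j.
Proof.
move=> pq; have q0 := prime_gt0 pq.
rewrite /divisor_mass smooth_partS pq big_mkcond big_divisors_mul ?smooth_part_gt0 ?smooth_part_coprime //.
apply: eq_bigr => j _; rewrite mulr_suml [RHS]big_mkcond; apply: eq_bigr => m _.
rewrite leq_divRL ?expn_gt0 ?q0 //; case: ifP => // _.
by rewrite natrM invfM natrX.
Qed.

Lemma divisor_mass_ge0 Q x : 0 <= divisor_mass Q x.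
Proof. by apply: sumr_ge0 => d _; rewrite invr_ge0. Qed.

Lemma count_powers_le f p a : (count_powers f p a <= f)%N.
Proof. by elim: f a => //= f IH a; case: ifP => // _; rewrite ltnS. Qed.

Lemma smooth_ok_step p A : prime (N.to_nat p) -> smooth_ok (N.to_nat p) A ->
  smooth_ok (N.to_nat p).+1 (geometric_push (count_powers 19 p p) p A A).
Proof.
move=> pp ok x; have p0 : (0 < p)%num by have := toR_prime pp; lia.
set V := count_powers _ _ _.
pose h x := toR (2 ^ 28) * divisor_mass (P (N.to_nat p)) x.
have h0 y : 0 <= h y by rewrite mulr_ge0 ?toR_ge0 ?divisor_mass_ge0.
have leA y : mass_upto A y <= \sum_(j < 1) h (y %/ N.to_nat p ^ j)%N / toR p ^+ j.
  by rewrite big_ord1 expn0 divn1 expr0 divr1; apply: ok.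
apply: le_trans (geometric_mass_upto V p0 ok leA x) _; rewrite addn0.
rewrite divisor_mass_prime // mulr_sumr.
have VG : (V.+1 <= G.+1)%N by rewrite ltnS (leq_trans _ G19) // count_powers_le.
rewrite -(subnKC VG) big_split_ord /=; apply: ler_wpDr.
  by apply: sumr_ge0 => j _; rewrite mulr_ge0 ?toR_ge0 // divr_ge0 ?divisor_mass_ge0 // exprn_ge0.
by apply: ler_sum => j _; rewrite /h -mulrA -toRE.
Qed.

Lemma smooth_ok_foldl n i l A :
  map N.to_nat l = [seq p <- iota n i | prime p] -> smooth_ok n A ->
  smooth_ok (n + i) (foldl (fun A p => geometric_push (count_powers 19 p p) p A A) A l).
Proof.
elim: i n l A => [|i IH] n l A /=.
  by case: l => // _; rewrite addn0.
rewrite addnS -addSn; case: (boolP (prime n)) => pn; last first.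
  by move=> e ok; apply: IH => // x; rewrite smooth_partS (negbTE pn).
case: l => [|p l] //= [pn' e] ok; apply: IH => //.
by rewrite -pn'; apply: smooth_ok_step; rewrite pn'.
Qed.

Lemma small_primesE : map N.to_nat small_primes = [seq p <- iota 0 200 | prime p].
Proof. by vm_compute. Qed.

Lemma total_le A : toR (total_mass A) <= mass_upto A (N.to_nat modulus_bound).-1.
Proof.
have hx k : (k < modulus_bound)%num -> (N.to_nat k <= (N.to_nat modulus_bound).-1)%N by lia.
move: (N.to_nat modulus_bound).-1 hx => x hx; rewrite /total_mass; set f := (fun a z => _).
suff H a : toR (foldl f a A) <= toR a + mass_upto A x.
  by apply: le_trans (H _) _; rewrite toRE add0r.
elim: A a => [|[k w] A IH] a; first by rewrite /mass_upto big_nil addr0.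
apply: le_trans (IH _) _; rewrite /mass_upto big_cons /f.
have [/hx /= ->|_] := N.ltb_spec k modulus_bound; first by rewrite toRD addrA.
by rewrite lerD2l; case: ifP => // _; rewrite lerDr toR_ge0.
Qed.

Lemma smooth_total : toR (total_mass smooth_mass) <=
  toR (2 ^ 28) * \sum_(d <- divisors (P 200) | (d < N.to_nat modulus_bound)%N) d%:R^-1.
Proof.
apply: le_trans (total_le _) _.
have ok0 : smooth_ok 0 [:: (1, 2 ^ 28)%num].
  move=> x; rewrite /mass_upto /divisor_mass /smooth_part big_ord0 unlock /=.
  by case: ifP; rewrite ?addr0 ?invr1 ?mulr1 ?mulr0.
apply: le_trans (smooth_ok_foldl small_primesE ok0 _) _.
rewrite add0n; apply: ler_wpM2l; first exact: toR_ge0.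
rewrite /divisor_mass le_eqVlt; apply/orP; left; apply/eqP; apply: eq_bigl => d.
by rewrite -ltnS prednK //; lia.
Qed.

Definition distorted_ok M n (s : N * N * seq (N * N) * N) :=
  let '(loss, E, mu, F) := s in
  distorted_stage r K G 1000%:R n (M - toR loss / c) (toR E / c) (real_mass mu) (toR F / c).

Lemma distorted_ok_step M p s : prime (N.to_nat p) -> (p < 4000)%num ->
  distorted_ok M (N.to_nat p) s -> distorted_ok M (N.to_nat p).+1 (distorted_step s p).
Proof.
case: s => [[[loss E] mu] F] pp p4000; have p1 := toR_prime pp.
have p0 : (0 < p)%num by lia.
have q1 : 2 <= toR p by rewrite toRE ler_nat prime_gt1.
have q4000 : toR p <= 4 * 1000.
  by rewrite toRE -natrM ler_nat; lia.
have c3 : toR 3 = 3 by rewrite toRE (_ : N.to_nat 3 = 3%N).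
have c4 : toR 4 = 4 by rewrite toRE (_ : N.to_nat 4 = 4%N).
have c1 : toR 1 = 1 by rewrite toRE.
move=> st; apply: (distorted_stage_prime pp _ st).
- by rewrite -toRE; lra.
- exact: nonneg_real_mass.
- apply: spread_step_mass; first exact: leq_trans G19.
  case=> // _; rewrite expn1 -toRE.
  apply: (@le_trans _ _ (toR (2 ^ 22) / toR (3 * p) / toR (2 ^ 20))).
    apply: ler_wpM2r; first by rewrite invr_ge0 toR_ge0.
    by apply: toR_div; lia.
  rewrite toRM c3 (_ : 2 ^ 22 = 4 * 2 ^ 20)%num // toRM c4.
  have : toR (2 ^ 20) != 0 by rewrite lt0r_neq0 // toR_gt0.
  move: (toR (2 ^ 20)) => x x0; rewrite le_eqVlt; apply/orP; left; apply/eqP.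
  by field; apply/andP; split=> //; lra.
- rewrite -toRE toRD mulrDl opprD addrA lerD2l lerN2 below_real_mass.
  set mm := mass _ mu.
  have cd : toR (4 * E + below_val (p - 1) mu - (p - 1) * unit_mass) / toR (3 * (p - 1)) <=
     toR (cdiv (4 * E + below_val (p - 1) mu - (p - 1) * unit_mass) (3 * (p - 1))).
    by apply: toR_cdiv; lia.
  rewrite ler_pdivlMr //; apply: le_trans cd.
  have num : 4 * toR E + 4 * mm - (toR p - 1) * c <=
      toR (4 * E + below_val (p - 1) mu - (p - 1) * unit_mass).
    apply: le_trans (toRB_ge _ _ _); rewrite toRD !toRM c4 toR_pred // mass_below_val.
    rewrite toR_pred // lerD2r lerD2l le_eqVlt; apply/orP; left; apply/eqP.
    by congr (_ * _); apply: eq_bigr => z _; rewrite mul1n.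
  have d0 : 0 < toR (3 * (p - 1)) by apply: toR_gt0; lia.
  rewrite ler_pdivlMr //; apply: le_trans num.
  rewrite toRM c3 toR_pred // le_eqVlt; apply/orP; left; apply/eqP; field.
  by apply/andP; split; [lra | rewrite lt0r_neq0].
- rewrite -toRE; apply: (fixed_point_le (x := toR E)) => //; first by rewrite divr_ge0 //; lra.
  apply: le_trans (toR_cdiv _ _ _); last lia.
  rewrite !toRM c3 c4 toR_pred // le_eqVlt; apply/orP; left; apply/eqP; field; lra.
- rewrite -toRE; apply: (fixed_point_le (x := toR F)) => //.
    by rewrite divr_ge0 ?exprn_ge0 //; lra.
  apply: le_trans (toR_cdiv _ _ _); last nia.
  have e3 : toR (3 * p - 1) = 3 * toR p - 1 by rewrite toR_pred ?toRM ?c3 //; lia.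
  rewrite !toRM c3 c4 e3 toR_pred // le_eqVlt; apply/orP; left; apply/eqP; field; lra.
Qed.

End Runs.

(** * Correctness of the sieve *)

Section Sieve.

Lemma size_mark q c l : size (mark_multiples q c l) = size l.
Proof. by elim: l c => [|b l IH] [|c] //=; rewrite IH. Qed.

Lemma nth_mark q c l i : nth false (mark_multiples q c l) i =
  nth false l i && ~~ ((c <= i)%N && (q.+1 %| i - c)%N).
Proof.
elim: l c i => [|b l IH] [|c] [|i] //=; first by rewrite andbF.
- rewrite IH subn0; congr (_ && ~~ _); case: (leqP q i) => [qi|iq] /=.
    by rewrite -{2}(subnK qi) -addnS dvdn_addl.
  by apply/esym/negbTE/negP => /(dvdn_leq (ltn0Sn _)); rewrite ltnS leqNgt iq.
- by rewrite andbT.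
- by rewrite IH subSS.
Qed.

Lemma nth_double_up k l i :
  all id l -> (i < 2 ^ k * size l)%N -> nth false (double_up k l) i.
Proof.
elim: k l => [|k IH] l al; first by rewrite mul1n => il; apply: (allP al); apply: mem_nth.
move=> il; apply: IH; first by rewrite all_cat al.
by rewrite size_cat mulnDr -mulnDl addnn -mul2n -expnS.
Qed.

Lemma size_double_up k l : size (double_up k l) = (2 ^ k * size l)%N.
Proof.
elim: k l => [|k IH] l; first by rewrite mul1n.
by rewrite /= IH size_cat mulnDr -mulnDl addnn -mul2n -expnS.
Qed.

Definition survives (n : nat) := all (fun p => ~~ (N.to_nat p %| n)%N) small_primes.

Definition sieved n (l : seq bool) := forall i, (i < size l)%N -> nth false l i = survives (n + i).

(** [c] is the least number with [p] dividing [200 + c]. *)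
Lemma mark_dvd (p : N) i : (0 < p)%num ->
  let c := N.to_nat ((p - 200 mod p) mod p) in
  ((c <= i)%N && ((N.to_nat (p - 1)).+1 %| i - c)%N) = (N.to_nat p %| N.to_nat 200 + i)%N.
Proof.
move=> p0; have -> : (N.to_nat (p - 1)).+1 = N.to_nat p by lia.
have [k [ek cp]] : exists k, (200 + (p - 200 mod p) mod p = p * k /\ (p - 200 mod p) mod p < p)%num.
  have := N.div_mod' 200 p; have := N.mod_lt 200 p; set r := (200 mod p)%num.
  set d := (200 / p)%num => rp e; have [r0|r0] := N.eq_dec r 0.
    by exists d; rewrite r0 N.sub_0_r N.Div0.mod_same; lia.
  by exists (d + 1)%num; rewrite N.mod_small; lia.
move: ek cp; set c := ((p - _) mod p)%num => ek cp /=.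
have dv : (N.to_nat p %| N.to_nat 200 + N.to_nat c)%N.
  by apply/dvdnP; exists (N.to_nat k); lia.
case: (leqP (N.to_nat c) i) => ci /=.
  rewrite -[in RHS](subnKC ci) addnA dvdn_addr //.
apply/esym/negP => dv'.
have := dvdn_sub dv dv'; rewrite subnDl => /dvdn_leq; rewrite subn_gt0 ci => /(_ isT).
lia.
Qed.

Lemma sieve_sieved k : sieved (N.to_nat 200) (sieve k).
Proof.
rewrite /sieve /sieved /survives.
have: all (fun p => N.ltb 0 p) small_primes by [].
elim/last_ind: small_primes => [_|ps p IH]; rewrite ?all_rcons ?foldl_rcons.
  by move=> i; rewrite size_double_up => il; apply: nth_double_up.
move=> /andP[p0 /IH {}IH] i; rewrite size_mark nth_mark mark_dvd; last by case: N.ltb_spec p0.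
by move=> il; rewrite IH // all_rcons andbC.
Qed.

Lemma size_sieve k : size (sieve k) = (2 ^ k)%N.
Proof.
rewrite /sieve; elim/last_ind: small_primes => [|ps p IH]; rewrite ?foldl_rcons ?size_mark //.
by rewrite size_double_up muln1.
Qed.

Lemma sieved_cons n b l : sieved n (b :: l) -> b = survives n /\ sieved n.+1 l.
Proof.
move=> sv; split; first by have := sv 0%N (ltn0Sn _); rewrite addn0.
by move=> i il; have := sv i.+1 il; rewrite addnS -addSn.
Qed.

Lemma small_primes_mem p : p \in small_primes -> prime (N.to_nat p) /\ (N.to_nat p < 200)%N.
Proof.
move=> ps; have : N.to_nat p \in [seq q <- iota 0 200 | prime q].
  by rewrite -small_primesE map_f.
by rewrite mem_filter mem_iota => /andP[].
Qed.

Lemma prime_survives n : (200 <= n)%N -> prime n -> survives n.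
Proof.
move=> n200 pn; apply/allP => p /small_primes_mem[pp p200].
by rewrite dvdn_prime2 // neq_ltn (leq_trans p200).
Qed.

(* Beyond [211 ^ 2] some composite numbers survive the sieve as well; treating
   them as primes only worsens the second moment bound. *)
Lemma survives_prime n : (1 < n < 4000)%N -> survives n -> prime n.
Proof.
move=> /andP[n1 n4000] /allP sv; apply: ltn_pdiv2_prime; first exact: ltnW.
rewrite ltnNge; apply/negP => le_n.
have lt_pdiv : (pdiv n < 200)%N.
  rewrite ltnNge; apply/negP => q200; have : (200 ^ 2 <= n)%N.
    by apply: leq_trans le_n; rewrite leq_exp2r.
  by apply/negP; rewrite -ltnNge (leq_trans n4000).
have : pdiv n \in map N.to_nat small_primes.
  by rewrite small_primesE mem_filter pdiv_prime // andTb mem_iota.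
by case/mapP => p ps e; have := sv p ps; rewrite -e pdiv_dvd.
Qed.

End Sieve.

(** * Correctness of the runs along the sieve *)

Section SieveRuns.
Variable R : realFieldType.
Variables (r : nat -> nat) (K G : nat).
Hypothesis G19 : (19 <= G)%N.
Local Notation toR := (toR R).
Local Notation c := (toR unit_mass).

Lemma distorted_run_ok (M : R) l n s :
  (200 <= N.to_nat n)%N -> (n <= 4000)%num -> sieved (N.to_nat n) l ->
  (4000 - N.to_nat n <= size l)%N -> distorted_ok r K G M (N.to_nat n) s ->
  let '(s', l') := distorted_run l n s in
  [/\ distorted_ok r K G M (N.to_nat 4000) s', sieved (N.to_nat 4000) l' &
     (size l + N.to_nat n = size l' + N.to_nat 4000)%N].
Proof.
elim: l n s => [|b l IH] n s n200 n4000 sv szl ok.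
  have e : n = 4000%num by move: szl => /=; lia.
  by rewrite /distorted_run -e.
rewrite [distorted_run _ _ _]/=; case: N.ltb_spec => n4; last first.
  have e : n = 4000%num by lia.
  by rewrite -e.
have [eb sv'] := sieved_cons sv.
have nS : N.to_nat (n + 1) = (N.to_nat n).+1 by lia.
have : distorted_ok r K G M (N.to_nat (n + 1)) (if b then distorted_step s n else s).
  rewrite nS eb; case: ifP => [sn|/negbT sn].
    by apply: distorted_ok_step => //; apply: survives_prime => //; lia.
  case: s ok => [[[loss E] mu] F] ok; apply: distorted_stage_next => //.
  by apply: contra sn; apply: prime_survives.
move=> ok'; have := IH (n + 1)%num _ _ _ _ _ ok'; rewrite nS.
have szl' : (4000 - (N.to_nat n).+1 <= size l)%N by move: szl => /=; lia.
move=> /(_ (leqW n200) ltac:(lia) sv' szl').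
by case: (distorted_run _ _ _) => s' l' [? ? e]; split=> //; rewrite -e addSn addnS.
Qed.

Definition square_ok (M : R) n (T F : N) :=
  square_stage r K G n (M - 4 / 3 * (toR T / c)) (toR F / c).

(** For composite [n] the stage itself is unchanged, and raising [T] and [F] weakens the claim. *)
Lemma square_ok_step M n T F : (1 < n)%num -> square_ok M (N.to_nat n) T F ->
  let t := cdiv F ((n - 1) * (n - 1)) in
  square_ok M (N.to_nat n).+1 (T + t) (F + cdiv (4 * ((3 * n - 1) * t)) 3).
Proof.
move=> n1 ok t; have c0 : 0 < c by apply: unit_mass_gt0.
have q1 : 2 <= toR n by rewrite toRE ler_nat; lia.
have c3 : toR 3 = 3 by rewrite toRE (_ : N.to_nat 3 = 3%N).
have c4 : toR 4 = 4 by rewrite toRE (_ : N.to_nat 4 = 4%N).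
have F0 : 0 <= toR F by apply: toR_ge0.
have t_ge : toR F / (toR n - 1) ^+ 2 <= toR t.
  apply: le_trans (toR_cdiv _ _ _); last nia.
  by rewrite toRM toR_pred ?expr2 //; lia.
have t0 := toR_ge0 R t.
have dT : toR (T + t) / c = toR T / c + toR t / c by rewrite toRD mulrDl.
have e3 : toR (3 * n - 1) = 3 * toR n - 1 by rewrite toR_pred ?toRM ?c3 //; lia.
have dF : toR F / c + 4 / 3 * (3 * toR n - 1) * (toR t / c) <=
   toR (F + cdiv (4 * ((3 * n - 1) * t)) 3) / c.
  have -> : toR F / c + 4 / 3 * (3 * toR n - 1) * (toR t / c) =
     (toR F + 4 / 3 * (3 * toR n - 1) * toR t) / c by ring.
  apply: ler_wpM2r; first by rewrite invr_ge0 ltW.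
  rewrite toRD lerD2l; apply: le_trans (toR_cdiv _ _ _); last lia.
  by rewrite !toRM c3 c4 e3; lra.
have tc : toR F / c / (toR n - 1) ^+ 2 <= toR t / c.
  by rewrite mulrAC; apply: ler_wpM2r => //; rewrite invr_ge0 ltW.
case: (boolP (prime (N.to_nat n))) => [pn|npn]; last first.
  apply: square_stage_next => //; apply: square_stage_le ok; rewrite ?dT.
    have : 0 <= toR t / c by rewrite divr_ge0 // ltW.
    lra.
  apply: le_trans dF; rewrite lerDl mulr_ge0 ?divr_ge0 ?(ltW c0) //; lra.
apply: square_stage_le (square_stage_prime pn ok); rewrite -toRE.
  rewrite dT; move: tc; rewrite -mulrA; lra.
apply: le_trans dF; rewrite mulrDr mulr1 lerD2l.
have -> : toR F / c * (4 / 3 * (3 * toR n - 1) / (toR n - 1) ^+ 2) =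
   4 / 3 * (3 * toR n - 1) * (toR F / c / (toR n - 1) ^+ 2) by ring.
by apply: ler_wpM2l => //; lra.
Qed.

Lemma square_run_ok (M : R) l n T F :
  (200 <= N.to_nat n)%N -> (n <= 2 ^ 17)%num -> sieved (N.to_nat n) l ->
  (N.to_nat (2 ^ 17 - n) <= size l)%N -> square_ok M (N.to_nat n) T F ->
  let '(T', F') := square_run l n T F in square_ok M (N.to_nat (2 ^ 17)) T' F'.
Proof.
elim: l n T F => [|b l IH] n T F n200 n17 sv szl ok.
  have e : n = (2 ^ 17)%num by move: szl; rewrite leqn0 => /eqP; lia.
  by rewrite /square_run -e.
rewrite [square_run _ _ _ _]/=; case: N.ltb_spec => n4; last first.
  by have -> : (2 ^ 17)%num = n by lia.
have [eb sv'] := sieved_cons sv.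
have nS : N.to_nat (n + 1) = (N.to_nat n).+1 by lia.
have IH' := IH (n + 1)%num _ _ _ _ _ _; rewrite nS in IH'.
have szl' : (N.to_nat (2 ^ 17 - (n + 1)) <= size l)%N.
  by move: szl; rewrite (_ : size (b :: l) = (size l).+1) //; lia.
have n17' : (n + 1 <= 2 ^ 17)%num by lia.
case: b eb {sv} szl => eb szl.
  apply: IH' => //; first exact: leqW.
  by apply: square_ok_step => //; lia.
apply: IH' => //; first exact: leqW.
apply: square_stage_next => //; apply: contraFN (esym eb).
exact: prime_survives.
Qed.

End SieveRuns.

(** * Conclusion *)

Lemma to_nat_pow2 k : N.to_nat (2 ^ N.of_nat k) = (2 ^ k)%N.
Proof.
by elim: k => // k IH; rewrite Nat2N.inj_succ N.pow_succ_r' N2Nat.inj_mul IH expnS.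
Qed.

Lemma to_nat_2_17 : N.to_nat (2 ^ 17) = (2 ^ 17)%N.
Proof. exact: (to_nat_pow2 17). Qed.

Lemma square_stage_start (R : realFieldType) r G : (19 <= G)%N ->
  exists (m F : R), square_stage r (N.to_nat modulus_bound) G (2 ^ 17) m F /\
    11 / 10 * F / (2 ^ 17)%:R < m.
Proof.
move=> G19; set K := N.to_nat modulus_bound.
have c0 : 0 < toR R unit_mass by apply: unit_mass_gt0.
have toR0 : toR R 0 = 0 by rewrite toRE.
have := smooth_total R G19; have := final_checkP; rewrite /final_check.
(* Computed values are generalised one after another, so that no later tactic evaluates them. *)
move: (total_mass smooth_mass) => tot final tot_le; move: final.
have ok0 : uniform_ok R G 0 (unit_mass, [:: (1%num, unit_mass)], unit_mass).
  rewrite /uniform_ok /real_mass /map divff ?lt0r_neq0 // (_ : N.to_nat 1 = 1%N) //.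
  exact: uniform_stage0.
have : uniform_ok R G (0 + 200) uniform_state.
  rewrite /uniform_state; apply: uniform_ok_foldl ok0 => //; exact: small_primesE.
case: uniform_state => [[EA mu] FA] okA.
set S : R := toR R tot / toR R (2 ^ 28).
have leS : S <= \sum_(d <- divisors (smooth_part G 200) | (d < K)%N) d%:R^-1.
  rewrite ler_pdivrMr ?toR_gt0 // mulrC; exact: tot_le.
have := remove_smooth r okA leS; set M := 1 - (_ - S) => st.
have ok1 : distorted_ok r K G M (N.to_nat 200) (0%num, EA, mu, FA).
  by rewrite /distorted_ok toR0 mul0r subr0.
have sv0 := @sieve_sieved 17; have sz0 := size_sieve 17.
move: (sieve 17) sv0 sz0 => l0 sv0 sz0.
have big17 : (4000 <= 2 ^ 17)%N.
  by apply: (@leq_trans (2 ^ 12)); rewrite // leq_exp2l.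
have big17' : (4000 - N.to_nat 200 <= 2 ^ 17)%N by apply: leq_trans (leq_subr _ _) big17.
rewrite -sz0 in big17'; have le200 : (200 <= N.to_nat 200)%N by lia.
have le4000 : (200 <= 4000)%num by lia.
have := @distorted_run_ok R r K G G19 M l0 200 (0%num, EA, mu, FA) le200 le4000 sv0 big17' ok1.
case: (distorted_run l0 200 (0%num, EA, mu, FA)) => [[[[loss E] mu'] FB] l] [okB sv szl].
have ok2 : square_ok r K G (M - toR R loss / toR R unit_mass) (N.to_nat 4000) 0 FB.
  have := distorted_square_stage okB.
  by rewrite /square_ok toR0 mul0r mulr0 subr0.
have szl' : (N.to_nat (2 ^ 17 - 4000) <= size l)%N.
  by move: szl; rewrite sz0 -to_nat_2_17; lia.
have le4000' : (200 <= N.to_nat 4000)%N by lia.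
have le17 : (4000 <= 2 ^ 17)%num by lia.
have := @square_run_ok R r K G G19 _ l 4000 0 FB le4000' le17 sv szl' ok2.
case: (square_run l 4000 0 FB) => T F okC.
rewrite to_nat_2_17 in okC.
move=> /N.ltb_spec0 lt_final.
exists (M - toR R loss / toR R unit_mass - 4 / 3 * (toR R T / toR R unit_mass)), (toR R F / toR R unit_mass).
split=> //.
suff: 11 / 10 * (toR R F / toR R unit_mass) / toR R (2 ^ 17) <
    M - toR R loss / toR R unit_mass - 4 / 3 * (toR R T / toR R unit_mass).
  by rewrite (toRE R (2 ^ 17)) to_nat_2_17.
clear - lt_final c0.
have {lt_final} : toR R (EA + loss + cdiv (4 * T) 3 + cdiv (11 * F) (10 * 2 ^ 17)) <
    toR R (unit_mass + 2 ^ 4 * tot).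
  by rewrite !toRE ltr_nat; lia.
have T_le : toR R (4 * T) / toR R 3 <= toR R (cdiv (4 * T) 3) by apply: toR_cdiv.
have F_le : toR R (11 * F) / toR R (10 * 2 ^ 17) <= toR R (cdiv (11 * F) (10 * 2 ^ 17)).
  by apply: toR_cdiv.
have p17 : 0 < toR R (2 ^ 17) by apply: toR_gt0.
have p28 : 0 < toR R (2 ^ 28) by apply: toR_gt0.
have p4 : 0 < toR R (2 ^ 4) by apply: toR_gt0.
have e32 : toR R unit_mass = toR R (2 ^ 4) * toR R (2 ^ 28) by rewrite -toRM.
have n3 : toR R 3 = 3 by rewrite toRE (_ : N.to_nat 3 = 3%N).
have n4 : toR R 4 = 4 by rewrite toRE (_ : N.to_nat 4 = 4%N).
have n10 : toR R 10 = 10 by rewrite toRE (_ : N.to_nat 10 = 10%N).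
have n11 : toR R 11 = 11 by rewrite toRE (_ : N.to_nat 11 = 11%N).
move: T_le F_le; rewrite /M /S !toRD !toRM n3 n4 n10 n11.
move=> T_le F_le lt_final; rewrite -(ltr_pM2r c0).
have -> : 11 / 10 * (toR R F / toR R unit_mass) / toR R (2 ^ 17) * toR R unit_mass =
   11 * toR R F / (10 * toR R (2 ^ 17)) by field; apply/andP; split; apply: lt0r_neq0.
have -> : (1 - (toR R EA / toR R unit_mass - toR R tot / toR R (2 ^ 28)) -
     toR R loss / toR R unit_mass - 4 / 3 * (toR R T / toR R unit_mass)) * toR R unit_mass =
  toR R unit_mass + toR R tot * (toR R unit_mass / toR R (2 ^ 28)) - toR R EA -
     toR R loss - 4 * toR R T / 3.
  by field; apply/andP; split; apply: lt0r_neq0.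
have -> : toR R unit_mass / toR R (2 ^ 28) = toR R (2 ^ 4) by rewrite e32 mulfK // lt0r_neq0.
by lra.
Qed.

Lemma square_stage_dyadic (R : realFieldType) r G k : (19 <= G)%N ->
  exists (m F : R), square_stage r (N.to_nat modulus_bound) G (2 ^ (17 + k)) m F /\
    11 / 10 * F / (2 ^ (17 + k))%:R < m.
Proof.
move=> G19; elim: k => [|k [m [F [st mF]]]]; first by rewrite addn0; apply: square_stage_start.
by rewrite addnS; apply: square_stage_double st mF; apply: leq_addr.
Qed.

Lemma square_stage_mass_gt0 (R : realFieldType) r K G b n (m F : R) :
  square_stage r K G b m F -> 11 / 10 * F / n%:R < m -> 0 < m.
Proof.
move=> /square_stage_ge0 F0; apply: le_lt_trans; apply: divr_ge0; last exact: ler0n.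
by apply: mulr_ge0 F0; rewrite divr_ge0 ?ler0n.
Qed.

(** One power of two above [n] serves both as the bound on the primes and as the exponent [G], so
    every modulus below [n] divides the smooth part. *)
Lemma uncovered_below (r : nat -> nat) n :
  exists x, forall e, (N.to_nat modulus_bound <= e < n)%N -> x != r e %[mod e].
Proof.
pose k := (maxn 19 n - 17)%N.
have k17 : (17 + k = maxn 19 n)%N by rewrite /k subnKC // leq_max.
have lt_pow : (maxn 19 n < 2 ^ (17 + k))%N by rewrite -k17 ltn_expl.
have G19 : (19 <= 2 ^ (17 + k))%N by rewrite (leq_trans _ (ltnW lt_pow)) // leq_max leqnn.
have [m [F [st mF]]] := square_stage_dyadic rat r k G19.
have m0 := square_stage_mass_gt0 st mF.
have K0 : (0 < N.to_nat modulus_bound)%N by rewrite /modulus_bound; lia.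
have [x xP] := square_stage_uncovered K0 (leqnn _) m0 st.
exists x => e /andP[Ke en]; apply: xP; rewrite Ke (leq_trans en) //.
by apply: leq_trans (ltnW lt_pow); apply: leq_maxr.
Qed.

Lemma modulus_bound_le : (N.to_nat modulus_bound <= 616000)%N.
Proof. by vm_compute. Qed.

Theorem theorem8p1 (k : nat) (a : 'I_k -> int) (d : 'I_k -> nat)
    (d_distinct : injective d) (d_large : forall i : 'I_k, (616000 <= d i)%N) :
  (\bigcup_(i in [set: 'I_k]) arith_prog (a i) (d i) <> [set: int])%classic.
Proof.
(* Distinct moduli make the residue a function of the modulus. Integers that are not moduli get
   residue 0, which only adds progressions to avoid. *)
pose r e := if [pick i | d i == e] is Some i then absz (a i %% e)%Z else 0%N.
have [x xP] := uncovered_below r (\max_i d i).+1.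
move=> cover; have : setT (x%:Z) by [].
rewrite -cover => -[i _ [m _ e]].
have Kd : (N.to_nat modulus_bound <= d i)%N := leq_trans modulus_bound_le (d_large i).
have d0 : (0 < d i)%N by apply: leq_trans Kd; rewrite /modulus_bound; lia.
have := xP (d i); rewrite Kd ltnS leq_bigmax => /(_ isT) /eqP; apply.
rewrite /r; case: pickP => [j /eqP/d_distinct ->|/(_ i)]; last by rewrite eqxx.
have : ((x %% d i)%N : int) = (a i %% d i)%Z.
  by rewrite -modz_nat -e addrC mulrC modzMDl.
by move=> <-; rewrite absz_nat modn_mod.
Qed.
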